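(* Let $b\ge2$ be an integer, $1/b<\gamma<1$ and $\psi(x)=-2\pi\sin(2\pi x)$. Then there exists a positive integer $q$ such that $\sigma(q)<(b\gamma)^q$.
   Context: $\mathcal{A}=\{0,\dots,b-1\}$. $S(x,\mathbf{i})=\sum_{n\ge1}\gamma^{n-1}\psi\big(\frac{x+i_1+i_2b+\cdots+i_nb^{n-1}}{b^n}\big)$ for $\mathbf{i}\in\mathcal{A}^{\mathbb{Z}^+}$, $S'=\partial_xS$. For $\mathbf{u}\in\mathcal{A}^q$, $x(\mathbf{u})=(x+u_1+u_2b+\cdots+u_qb^{q-1})/b^q$. Sequences $\mathbf{i},\mathbf{j}$ are $(\varepsilon,\delta)$-tangent at $x_0$ if $|S(x_0,\mathbf{i})-S(x_0,\mathbf{j})|\le\varepsilon$ and $|S'(x_0,\mathbf{i})-S'(x_0,\mathbf{j})|\le\delta$. $E(q,x_0;\varepsilon,\delta)$: pairs $(\mathbf{k},\mathbf{l})\in\mathcal{A}^q\times\mathcal{A}^q$ such that for some $\mathbf{u},\mathbf{v}\in\mathcal{A}^{\mathbb{Z}^+}$ the concatenations $\mathbf{ku},\mathbf{lv}$ are $(\varepsilon,\delta)$-tangent at $x_0$. Weight function: measurable $\omega:[0,1)\to(0,\infty)$ with $\omega,1/\omega$ bounded. Admissible testing function of order $q$: measurable $V:[0,1)\times\mathcal{A}^q\times\mathcal{A}^q\to[0,\infty)$ such that for some $\varepsilon,\delta>0$, $V(x,\mathbf{u},\mathbf{v})V(x,\mathbf{v},\mathbf{u})\ge1$ whenever $x\in[0,1)$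 and $(\mathbf{u},\mathbf{v})\in E(q,x;\varepsilon,\delta)$. $\Sigma_{V,\omega}(x)=\sup_{\mathbf{u}}\frac{\omega(x)}{\omega(x(\mathbf{u}))}\sum_{\mathbf{v}}V(x,\mathbf{u},\mathbf{v})$; $\sigma(q)=\inf_{\omega,V}\|\Sigma_{V,\omega}\|_\infty$. *)

(* Defs.v *)
From Stdlib Require Import Reals Lra List ClassicalEpsilon.
Open Scope R_scope.

Definition psi (x : R) : R := - (2 * PI) * sin (2 * PI * x).

(* Sequences i in A^{Z+} are nat -> nat, with i 0 = i_1; digits < b. *)
Definition digit_seq (b : nat) (i : nat -> nat) : Prop := forall n, (i n < b)%nat.

(* sum_{k=0}^{n-1} i_{k+1} b^k  (here i k = i_{k+1}) *)
Fixpoint prefix_val (b : nat) (i : nat -> nat) (n : nat) : R :=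
  match n with
  | O => 0
  | S m => prefix_val b i m + INR (i m) * INR b ^ m
  end.

(* n-th term (n >= 1 written as n+1): gamma^n psi((x + i_1 + ... + i_{n+1} b^n)/b^{n+1}) *)
Definition S_term (b : nat) (gamma : R) (x : R) (i : nat -> nat) (n : nat) : R :=
  gamma ^ n * psi ((x + prefix_val b i (S n)) / INR b ^ (S n)).

(* S(x,i): the sum of the (convergent) series *)
Definition S_fun (b : nat) (gamma : R) (x : R) (i : nat -> nat) : R :=
  epsilon (inhabits 0) (fun s => infinite_sum (S_term b gamma x i) s).

Definition S_der (b : nat) (gamma : R) (x : R) (i : nat -> nat) : R :=
  epsilon (inhabits 0) (fun l => derivable_pt_lim (fun y => S_fun b gamma y i) x l).

Definition tangent (b : nat) (gamma eps delta x0 : R) (i j : nat -> nat) : Prop :=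
  Rabs (S_fun b gamma x0 i - S_fun b gamma x0 j) <= eps /\
  Rabs (S_der b gamma x0 i - S_der b gamma x0 j) <= delta.

Definition word (b q : nat) (u : list nat) : Prop :=
  length u = q /\ Forall (fun d => (d < b)%nat) u.

Fixpoint words (b q : nat) : list (list nat) :=
  match q with
  | O => nil :: nil
  | S q' => flat_map (fun d => map (fun w => d :: w) (words b q')) (seq 0 b)
  end.

Definition concat_seq (k : list nat) (u : nat -> nat) : nat -> nat :=
  fun n => if Nat.ltb n (length k) then nth n k O else u (n - length k)%nat.

Definition xu (b : nat) (x : R) (u : list nat) : R :=
  (x + prefix_val b (fun n => nth n u O) (length u)) / INR b ^ (length u).

Definition E_set (b : nat) (gamma : R) (q : nat) (x0 eps delta : R)
  (k l : list nat) : Prop :=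
  word b q k /\ word b q l /\
  exists u v, digit_seq b u /\ digit_seq b v /\
    tangent b gamma eps delta x0 (concat_seq k u) (concat_seq l v).

Definition small_cover (A : R -> Prop) (e : R) : Prop :=
  exists a c : nat -> R, (forall n, a n <= c n) /\
    (forall x, A x -> exists n, a n <= x <= c n) /\
    (forall N, sum_f_R0 (fun n => c n - a n) N <= e).

Definition null_set (A : R -> Prop) : Prop := forall e, 0 < e -> small_cover A e.

Definition leb_measurable (A : R -> Prop) : Prop :=
  forall e, 0 < e -> exists G, open_set G /\ included A G /\
    small_cover (fun x => G x /\ ~ A x) e.

Definition meas_fun01 (f : R -> R) : Prop :=
  forall a, leb_measurable (fun x => 0 <= x < 1 /\ a < f x).

Definition weight_fun (omega : R -> R) : Prop :=
  meas_fun01 omega /\ (forall x, 0 <= x < 1 -> 0 < omega x) /\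
  exists C, forall x, 0 <= x < 1 -> omega x <= C /\ / omega x <= C.

Definition admissible (b : nat) (gamma : R) (q : nat)
  (V : R -> list nat -> list nat -> R) : Prop :=
  (forall u v, word b q u -> word b q v -> meas_fun01 (fun x => V x u v)) /\
  (forall x u v, 0 <= x < 1 -> word b q u -> word b q v -> 0 <= V x u v) /\
  exists eps delta, 0 < eps /\ 0 < delta /\
    forall x u v, 0 <= x < 1 -> E_set b gamma q x eps delta u v ->
      V x u v * V x v u >= 1.

Definition Sigma (b q : nat) (V : R -> list nat -> list nat -> R) (omega : R -> R)
  (x : R) : R :=
  fold_right Rmax 0
    (map (fun u => omega x / omega (xu b x u) *
                   fold_right Rplus 0 (map (fun v => V x u v) (words b q)))
         (words b q)).

(* ||f||_oo < c  on [0,1)  (essential sup is the inf of essential upper bounds) *)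
Definition esssup_lt (f : R -> R) (c : R) : Prop :=
  exists M, M < c /\ null_set (fun x => 0 <= x < 1 /\ M < f x).

(* Main.v *)
(** One letter at a time ([q = 1]) suffices. If [k <> l] are tangent at [x], then comparing partial
    sums of S and b S' with their geometric tails (ratios gamma and gamma / b) gives, for every
    depth n, two inequalities between sines and cosines of the points [x(u)], and these exclude
    tangency for most [x].

    For b >= 6 and b gamma > 2 the first derivative term alone forces [2x + k + l] to be close to
    a multiple of b, so a row of V has fewer than b gamma nonzero entries; for b >= 7 and
    b gamma <= 2 no two distinct letters are tangent.

    For the remaining b <= 6 the exclusion uses several levels and is carried out by ball
    arithmetic: the unit interval is cut into 64 cells, pairs of letters are shown not to be
    tangent outside a few cells, and a weight omega constant on the cells exploits that an inverse
    branch leaves these cells for some steps, bringing the bound down to 2^(1/N) when every visit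
    is followed by N - 1 steps outside. For b = 2 and gamma > 0.8093 visits may be consecutive, but
    only along one of the two branches; giving that branch the weight 0.618 in V and the other one
    its inverse yields the golden ratio. *)
Require Import Defs.
From Stdlib Require Import Reals Factorial Lra Lia Psatz List ZArith ClassicalEpsilon.
From Coquelicot Require Import Coquelicot.
Import ListNotations.
Open Scope R_scope.

(** * Taylor bounds for sine and cosine, and numerical bounds for pi *)

Lemma sin_term_val (a : R) (i : nat) (c : Z) :
  Z.of_nat (fact (2 * i + 1)) = c -> sin_term a i = (-1) ^ i * (a ^ (2 * i + 1) / IZR c).
Proof. intros <-. unfold sin_term. rewrite INR_IZR_INZ. reflexivity. Qed.

Lemma cos_term_val (a : R) (i : nat) (c : Z) :
  Z.of_nat (fact (2 * i)) = c -> cos_term a i = (-1) ^ i * (a ^ (2 * i) / IZR c).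
Proof. intros <-. unfold cos_term. rewrite INR_IZR_INZ. reflexivity. Qed.

Lemma Z_of_nat_fact_S (n : nat) :
  Z.of_nat (fact (S n)) = (Z.of_nat (S n) * Z.of_nat (fact n))%Z.
Proof. rewrite fact_simpl. apply Nat2Z.inj_mul. Qed.

(** Two consecutive Taylor sums, ending in degrees 11 and 13, enclose the sine. *)
Lemma sin_taylor_enclosure (a : R) :
  0 <= a <= PI ->
  0 <= sin a - (a - a ^ 3 / 6 + a ^ 5 / 120 - a ^ 7 / 5040 + a ^ 9 / 362880 - a ^ 11 / 39916800)
    <= a ^ 13 / 6227020800.
Proof.
  intros [H0 H1]. destruct (sin_bound a 2 H0 H1) as [Hl Hu].
  unfold sin_approx in Hl, Hu.
  change (2 * (2 + 1))%nat with 6%nat in Hu. change (2 * 2 + 1)%nat with 5%nat in Hl.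
  unfold sum_f_R0 in Hl, Hu.
  rewrite (sin_term_val a 0 1), (sin_term_val a 1 6), (sin_term_val a 2 120),
    (sin_term_val a 3 5040), (sin_term_val a 4 362880), (sin_term_val a 5 39916800) in Hl, Hu
    by (cbn [Nat.mul Nat.add]; rewrite ?Z_of_nat_fact_S; reflexivity).
  rewrite (sin_term_val a 6 6227020800) in Hu
    by (cbn [Nat.mul Nat.add]; rewrite ?Z_of_nat_fact_S; reflexivity).
  cbn [Nat.mul Nat.add] in Hl, Hu. lra.
Qed.

Lemma cos_taylor_enclosure (a : R) :
  0 <= a <= PI / 2 ->
  0 <= cos a - (1 - a ^ 2 / 2 + a ^ 4 / 24 - a ^ 6 / 720 + a ^ 8 / 40320 - a ^ 10 / 3628800)
    <= a ^ 12 / 479001600.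
Proof.
  intros [H0 H1]. destruct (cos_bound a 2) as [Hl Hu]; [lra | lra |].
  unfold cos_approx in Hl, Hu.
  change (2 * (2 + 1))%nat with 6%nat in Hu. change (2 * 2 + 1)%nat with 5%nat in Hl.
  unfold sum_f_R0 in Hl, Hu.
  rewrite (cos_term_val a 0 1), (cos_term_val a 1 2), (cos_term_val a 2 24),
    (cos_term_val a 3 720), (cos_term_val a 4 40320), (cos_term_val a 5 3628800) in Hl, Hu
    by (cbn [Nat.mul Nat.add]; rewrite ?Z_of_nat_fact_S; reflexivity).
  rewrite (cos_term_val a 6 479001600) in Hu
    by (cbn [Nat.mul Nat.add]; rewrite ?Z_of_nat_fact_S; reflexivity).
  cbn [Nat.mul Nat.add] in Hl, Hu. lra.
Qed.

(** The sine increases up to pi/2 and equals 1/2 at pi/6, so its Taylor enclosure at one sixth of a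
    candidate decides on which side of pi the candidate lies. *)
Lemma PI_enclosure : 3141591 / 1000000 < PI < 3141594 / 1000000.
Proof.
  pose proof PI2_3_2 as Hlow. pose proof PI_4 as Hup.
  unfold PI2 in Hlow.
  assert (Hs : sin (PI / 6) = 1 / 2) by apply sin_PI6.
  split; apply Rnot_le_lt; intro Hc.
  - assert (Hm : sin (PI / 6) <= sin (3141591 / 1000000 / 6)).
    { destruct (Rle_lt_or_eq_dec _ _ Hc) as [H | H].
      - left. apply sin_increasing_1; lra.
      - rewrite H. lra. }
    destruct (sin_taylor_enclosure (3141591 / 1000000 / 6)) as [_ Hb]; lra.
  - assert (Hm : sin (3141594 / 1000000 / 6) <= sin (PI / 6)).
    { destruct (Rle_lt_or_eq_dec _ _ Hc) as [H | H].
      - left. apply sin_increasing_1; lra.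
      - rewrite H. lra. }
    destruct (sin_taylor_enclosure (3141594 / 1000000 / 6)) as [Hb _]; lra.
Qed.

Lemma sin_lipschitz (x y : R) : Rabs (sin x - sin y) <= Rabs (x - y).
Proof.
  destruct (MVT_gen sin y x cos) as [c [_ Hc]].
  - intros z _. apply is_derive_Reals, derivable_pt_lim_sin.
  - intros z _. apply continuity_sin.
  - rewrite Hc, Rabs_mult. rewrite <- (Rmult_1_l (Rabs (x - y))) at 2.
    apply Rmult_le_compat_r; [apply Rabs_pos |].
    apply Rabs_le, COS_bound.
Qed.

Lemma cos_lipschitz (x y : R) : Rabs (cos x - cos y) <= Rabs (x - y).
Proof.
  rewrite !cos_sin. replace (x - y) with ((PI / 2 + x) - (PI / 2 + y)) by ring.
  apply sin_lipschitz.
Qed.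

(** By the mean value theorem the increment is t cos c with c within |t| of a, and the cosine is
    1-Lipschitz. *)
Lemma sin_taylor2 (a t : R) : Rabs (sin (a + t) - sin a - t * cos a) <= t ^ 2.
Proof.
  destruct (MVT_gen sin a (a + t) cos) as [c [Hr Hc]].
  - intros z _. apply is_derive_Reals, derivable_pt_lim_sin.
  - intros z _. apply continuity_sin.
  - rewrite Hc. replace (cos c * (a + t - a) - t * cos a) with (t * (cos c - cos a)) by ring.
    rewrite Rabs_mult.
    assert (Hca : Rabs (c - a) <= Rabs t).
    { revert Hr. unfold Rmin, Rmax. destruct (Rle_dec a (a + t));
        unfold Rabs; repeat destruct Rcase_abs; lra. }
    pose proof (cos_lipschitz c a).
    replace (t ^ 2) with (Rabs t * Rabs t) by (rewrite <- Rabs_mult, Rabs_right; [ring | nra]).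
    apply Rmult_le_compat_l; [apply Rabs_pos | lra].
Qed.

(** * The functions S and S' as sums of series *)

(** The point x(i_1 ... i_{n+1}): index n consumes n + 1 digits, in step with [S_term]. *)
Definition orbit_pt (b : nat) (x : R) (i : nat -> nat) (n : nat) : R :=
  (x + prefix_val b i (S n)) / INR b ^ (S n).

(** The derivative of [S_term] in x; the chain rule factor b^-(n+1) is split into 1/b and the ratio
    gamma/b of the series. *)
Definition S_der_term (b : nat) (gamma x : R) (i : nat -> nat) (n : nat) : R :=
  - (2 * PI) ^ 2 / INR b * ((gamma / INR b) ^ n * cos (2 * PI * orbit_pt b x i n)).

Lemma INR_base_ge (b : nat) : (2 <= b)%nat -> 2 <= INR b.
Proof. intro hb. apply (le_INR 2) in hb. simpl in hb. lra. Qed.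

Lemma base_pow_ge (b n : nat) : (2 <= b)%nat -> 1 <= INR b ^ n.
Proof. intro hb. apply pow_R1_Rle. apply INR_base_ge in hb. lra. Qed.

Lemma ratio_range (b : nat) (gamma : R) :
  (2 <= b)%nat -> 0 < gamma < 1 -> 0 < gamma / INR b < 1.
Proof.
  intros hb hg. apply INR_base_ge in hb. split; [apply Rdiv_lt_0_compat; lra |].
  apply Rmult_lt_reg_r with (INR b); [lra |]. unfold Rdiv.
  rewrite Rmult_assoc, Rinv_l by lra. lra.
Qed.

Lemma orbit_pt_0 (b : nat) (x : R) (i : nat -> nat) :
  (2 <= b)%nat -> orbit_pt b x i 0 = (x + INR (i O)) / INR b.
Proof. intro hb. apply INR_base_ge in hb. unfold orbit_pt. simpl. field. lra. Qed.

Lemma orbit_pt_S (b : nat) (x : R) (i : nat -> nat) (n : nat) :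
  (2 <= b)%nat -> orbit_pt b x i (S n) = (orbit_pt b x i n + INR (i (S n))) / INR b.
Proof.
  intro hb. unfold orbit_pt. pose proof (base_pow_ge b (S n) hb). apply INR_base_ge in hb.
  change (prefix_val b i (S (S n))) with (prefix_val b i (S n) + INR (i (S n)) * INR b ^ S n).
  change (INR b ^ S (S n)) with (INR b * INR b ^ S n).
  field. lra.
Qed.

Lemma digit_step_range (b : nat) (y : R) (d : nat) :
  (2 <= b)%nat -> (d < b)%nat -> 0 <= y <= 1 -> 0 <= (y + INR d) / INR b <= 1.
Proof.
  intros hb Hd Hy. apply INR_base_ge in hb. apply le_INR in Hd. rewrite S_INR in Hd.
  pose proof (pos_INR d). split; [apply Rdiv_le_0_compat; lra |].
  apply Rmult_le_reg_r with (INR b); [lra |]. unfold Rdiv. rewrite Rmult_assoc, Rinv_l by lra. lra.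
Qed.

Lemma ex_series_geom_bounded (c M : R) (a : nat -> R) :
  0 <= c < 1 -> (forall n, Rabs (a n) <= M * c ^ n) -> ex_series a.
Proof.
  intros Hc Ha. apply (ex_series_le a (fun n => M * c ^ n)).
  - exact Ha.
  - apply (ex_series_scal M (fun n => c ^ n)), ex_series_geom.
    rewrite Rabs_right; lra.
Qed.

Lemma Series_geom_bounded (c M : R) (a : nat -> R) :
  0 <= c < 1 -> (forall n, Rabs (a n) <= M * c ^ n) -> Rabs (Series a) <= M / (1 - c).
Proof.
  intros Hc Ha.
  assert (Hg : ex_series (fun n => M * c ^ n)).
  { apply (ex_series_scal M (fun n => c ^ n)), ex_series_geom. rewrite Rabs_right; lra. }
  apply Rle_trans with (Series (fun n => Rabs (a n))).
  - apply Series_Rabs.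
    apply (ex_series_le (fun n => Rabs (a n)) (fun n => M * c ^ n)); [| exact Hg].
    intro n. change (norm (Rabs (a n))) with (Rabs (Rabs (a n))).
    rewrite Rabs_Rabsolu. apply Ha.
  - apply Rle_trans with (Series (fun n => M * c ^ n)).
    + apply Series_le; [| exact Hg]. intro n. split; [apply Rabs_pos | apply Ha].
    + rewrite Series_scal_l, Series_geom by (rewrite Rabs_right; lra). right; reflexivity.
Qed.

Section Tangency.
Context (b : nat) (gamma : R).
Hypothesis hb : (2 <= b)%nat.
Hypothesis hg : 0 < gamma < 1.

Let INR_b : 2 <= INR b := INR_base_ge b hb.
Let b_pow (n : nat) : 1 <= INR b ^ n := base_pow_ge b n hb.
Let ratio_lt : 0 < gamma / INR b < 1 := ratio_range b gamma hb hg.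

Lemma S_term_bound (x : R) (i : nat -> nat) (n : nat) :
  Rabs (S_term b gamma x i n) <= 2 * PI * gamma ^ n.
Proof.
  unfold S_term, psi. rewrite !Rabs_mult, Rabs_Ropp, (Rabs_right (2 * PI)) by (pose proof PI_RGT_0; lra).
  rewrite (Rabs_right (gamma ^ n)) by (apply Rle_ge, pow_le; lra).
  assert (H : Rabs (sin (2 * PI * ((x + prefix_val b i (S n)) / INR b ^ S n))) <= 1)
    by apply Rabs_le, SIN_bound.
  assert (0 <= gamma ^ n) by (apply pow_le; lra).
  pose proof PI_RGT_0. pose proof (Rabs_pos (sin (2 * PI * ((x + prefix_val b i (S n)) / INR b ^ S n)))).
  assert (0 <= gamma ^ n * PI) by nra. nra.
Qed.

Lemma ex_series_S_term (x : R) (i : nat -> nat) : ex_series (S_term b gamma x i).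
Proof.
  apply (ex_series_geom_bounded gamma (2 * PI)); [lra | apply S_term_bound].
Qed.

Lemma S_fun_Series (x : R) (i : nat -> nat) : S_fun b gamma x i = Series (S_term b gamma x i).
Proof.
  unfold S_fun. symmetry. apply is_series_unique, is_series_Reals.
  apply epsilon_spec. exists (Series (S_term b gamma x i)).
  apply is_series_Reals, Series_correct, ex_series_S_term.
Qed.

Lemma S_der_term_bound (x : R) (i : nat -> nat) (n : nat) :
  Rabs (S_der_term b gamma x i n) <= (2 * PI) ^ 2 / INR b * (gamma / INR b) ^ n.
Proof.
  pose proof INR_b. pose proof ratio_lt.
  unfold S_der_term. rewrite !Rabs_mult.
  assert (0 < (2 * PI) ^ 2 / INR b).
  { apply Rdiv_lt_0_compat; [| lra]. apply pow_lt. pose proof PI_RGT_0; lra. }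
  replace (- (2 * PI) ^ 2 / INR b) with (- ((2 * PI) ^ 2 / INR b)) by (unfold Rdiv; ring).
  rewrite Rabs_Ropp, (Rabs_right ((2 * PI) ^ 2 / INR b)) by lra.
  rewrite (Rabs_right ((gamma / INR b) ^ n)) by (apply Rle_ge, pow_le; lra).
  apply Rmult_le_compat_l; [lra |].
  rewrite <- (Rmult_1_r ((gamma / INR b) ^ n)) at 2.
  apply Rmult_le_compat_l; [apply pow_le; lra | apply Rabs_le, COS_bound].
Qed.

(** A quadratic remainder with constants summable in n: the termwise differentiation of the series
    rests on it. *)
Lemma S_term_taylor (x t : R) (i : nat -> nat) (n : nat) :
  Rabs (S_term b gamma (x + t) i n - S_term b gamma x i n - t * S_der_term b gamma x i n)
  <= (2 * PI) ^ 3 * t ^ 2 * gamma ^ n.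
Proof.
  pose proof (b_pow n) as Hbn. pose proof (b_pow (S n)) as Hbn'. pose proof INR_b.
  set (y := 2 * PI * orbit_pt b x i n). set (s := 2 * PI * (t / INR b ^ S n)).
  assert (E : S_term b gamma (x + t) i n - S_term b gamma x i n - t * S_der_term b gamma x i n
     = - (2 * PI) * gamma ^ n * (sin (y + s) - sin y - s * cos y)).
  { unfold S_term, S_der_term, psi. fold (orbit_pt b x i n).
    replace (2 * PI * ((x + t + prefix_val b i (S n)) / INR b ^ S n)) with (y + s)
      by (unfold y, s, orbit_pt; field; lra).
    fold y. replace ((gamma / INR b) ^ n) with (gamma ^ n / INR b ^ n)
      by (unfold Rdiv; rewrite Rpow_mult_distr, pow_inv; reflexivity).
    unfold s. simpl pow. field. lra. }
  rewrite E, !Rabs_mult, Rabs_Ropp, (Rabs_right (2 * PI)) by (pose proof PI_RGT_0; lra).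
  rewrite (Rabs_right (gamma ^ n)) by (apply Rle_ge, pow_le; lra).
  (* The increment of the argument carries the factor b^-(n+1), which is at most 1. *)
  assert (Hs : s ^ 2 <= (2 * PI) ^ 2 * t ^ 2).
  { unfold s. rewrite Rpow_mult_distr. apply Rmult_le_compat_l; [apply pow2_ge_0 |].
    unfold Rdiv. rewrite Rpow_mult_distr, pow_inv.
    assert (/ (INR b ^ S n) ^ 2 <= 1).
    { rewrite <- Rinv_1. apply Rinv_le_contravar; [lra | nra]. }
    pose proof (pow2_ge_0 t). nra. }
  replace ((2 * PI) ^ 3 * t ^ 2 * gamma ^ n) with (2 * PI * gamma ^ n * ((2 * PI) ^ 2 * t ^ 2)) by ring.
  apply Rmult_le_compat_l.
  - apply Rmult_le_pos; [pose proof PI_RGT_0; lra | apply pow_le; lra].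
  - apply Rle_trans with (s ^ 2); [apply sin_taylor2 | exact Hs].
Qed.

(** Summing the remainders puts the difference quotient with increment t within C |t| of the sum of
    the derivative terms. *)
Lemma S_fun_derivable (x : R) (i : nat -> nat) :
  derivable_pt_lim (fun y => S_fun b gamma y i) x (Series (S_der_term b gamma x i)).
Proof.
  pose proof ratio_lt.
  assert (HD : ex_series (S_der_term b gamma x i))
    by (apply (ex_series_geom_bounded (gamma / INR b) ((2 * PI) ^ 2 / INR b)); [lra | apply S_der_term_bound]).
  set (C := (2 * PI) ^ 3 / (1 - gamma)).
  assert (HC : 0 < C).
  { apply Rdiv_lt_0_compat; [apply pow_lt; pose proof PI_RGT_0; lra | lra]. }
  assert (Hq : forall t, Rabs (S_fun b gamma (x + t) i - S_fun b gamma x i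
                 - t * Series (S_der_term b gamma x i)) <= C * t ^ 2).
  { intro t. rewrite !S_fun_Series, <- Series_scal_l.
    rewrite <- !Series_minus.
    - replace (C * t ^ 2) with ((2 * PI) ^ 3 * t ^ 2 / (1 - gamma)) by (unfold C; field; lra).
      apply Series_geom_bounded; [lra | intro n; apply S_term_taylor].
    - apply (ex_series_minus (S_term b gamma (x + t) i) (S_term b gamma x i)); apply ex_series_S_term.
    - apply (ex_series_scal t (S_der_term b gamma x i)), HD.
    - apply ex_series_S_term.
    - apply ex_series_S_term. }
  intros e He. assert (Hd : 0 < e / C) by (apply Rdiv_lt_0_compat; lra).
  exists (mkposreal _ Hd). intros h Hh0 Hh. simpl in Hh.
  specialize (Hq h).
  replace ((S_fun b gamma (x + h) i - S_fun b gamma x i) / h - Series (S_der_term b gamma x i))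
    with ((S_fun b gamma (x + h) i - S_fun b gamma x i - h * Series (S_der_term b gamma x i)) / h)
    by (field; exact Hh0).
  assert (Hhp : 0 < Rabs h) by (apply Rabs_pos_lt, Hh0).
  rewrite Rabs_div by exact Hh0.
  apply Rmult_lt_reg_r with (Rabs h); [exact Hhp |].
  unfold Rdiv. rewrite Rmult_assoc, Rinv_l, Rmult_1_r by lra.
  apply Rle_lt_trans with (C * h ^ 2); [exact Hq |].
  replace (h ^ 2) with (Rabs h * Rabs h) by (rewrite <- Rabs_mult, Rabs_right; [ring | nra]).
  assert (C * Rabs h < e).
  { apply Rmult_lt_reg_r with (/ C); [apply Rinv_0_lt_compat, HC |].
    replace (C * Rabs h * / C) with (Rabs h) by (field; lra). exact Hh. }
  nra.
Qed.

Lemma S_der_Series (x : R) (i : nat -> nat) : S_der b gamma x i = Series (S_der_term b gamma x i).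
Proof.
  unfold S_der. apply (uniqueness_limite (fun y => S_fun b gamma y i) x).
  - apply epsilon_spec. exists (Series (S_der_term b gamma x i)). apply S_fun_derivable.
  - apply S_fun_derivable.
Qed.

(** * Partial sums and geometric tails under tangency *)

Fixpoint psum (a : nat -> R) (n : nat) : R :=
  match n with O => 0 | S m => psum a m + a m end.

Lemma Series_psum (a : nat -> R) (n : nat) :
  ex_series a -> Series a = psum a n + Series (fun m => a (n + m)%nat).
Proof.
  revert a. induction n as [| n IH]; intros a Ha.
  - simpl. rewrite Rplus_0_l. apply Series_ext. reflexivity.
  - rewrite (IH a Ha). simpl.
    rewrite (Series_incr_1 (fun m => a (n + m)%nat)).
    + rewrite Nat.add_0_r, <- Rplus_assoc. f_equal. apply Series_ext.
      intro m. f_equal. lia.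
    + apply ex_series_incr_n with (n := n) in Ha. exact Ha.
Qed.

(** The full sum is at most e and the tail after n terms at most M c^n / (1 - c); multiplying by 1 -
    c clears the denominator. *)
Lemma psum_geom_bound (c e M : R) (d : nat -> R) (n : nat) :
  0 < c < 1 -> (forall m, Rabs (d m) <= M) ->
  Rabs (Series (fun m => c ^ m * d m)) <= e ->
  (1 - c) * Rabs (psum (fun m => c ^ m * d m) n) <= M * c ^ n + e.
Proof.
  intros Hc Hd He.
  assert (Hcn : forall m, 0 < c ^ m) by (intro; apply pow_lt; lra).
  assert (Hb : forall m, Rabs (c ^ m * d m) <= M * c ^ m).
  { intro m. rewrite Rabs_mult, (Rabs_right (c ^ m)) by (specialize (Hcn m); lra).
    specialize (Hd m). specialize (Hcn m). nra. }
  rewrite (Series_psum _ n) in He by (apply (ex_series_geom_bounded c M); [lra | exact Hb]).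
  assert (Ht : Rabs (Series (fun m => c ^ (n + m) * d (n + m)%nat)) <= M * c ^ n / (1 - c)).
  { apply Series_geom_bounded; [lra |]. intro m. specialize (Hb (n + m)%nat).
    rewrite pow_add in Hb at 2. rewrite Rmult_assoc. exact Hb. }
  set (p := psum _ n) in *. set (t := Series _) in *.
  assert (He0 : 0 <= e) by (eapply Rle_trans; [apply Rabs_pos | exact He]).
  assert (Hp : Rabs p <= e + M * c ^ n / (1 - c)).
  { replace p with ((p + t) + (- t)) by ring.
    eapply Rle_trans; [apply Rabs_triang |]. rewrite Rabs_Ropp. lra. }
  apply Rle_trans with ((1 - c) * (e + M * c ^ n / (1 - c))).
  - apply Rmult_le_compat_l; lra.
  - rewrite Rmult_plus_distr_l. replace ((1 - c) * (M * c ^ n / (1 - c))) with (M * c ^ n) by (field; lra).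
    nra.
Qed.

Lemma sin_diff_bound (u v : R) : Rabs (sin u - sin v) <= 2.
Proof. pose proof (SIN_bound u). pose proof (SIN_bound v). apply Rabs_le. lra. Qed.

Lemma cos_diff_bound (u v : R) : Rabs (cos u - cos v) <= 2.
Proof. pose proof (COS_bound u). pose proof (COS_bound v). apply Rabs_le. lra. Qed.

(** The constant factor 2 pi exceeds 1, so dropping it preserves the tolerance. *)
Lemma tangent_sin_bound (tol delta x : R) (i j : nat -> nat) (n : nat) :
  tangent b gamma tol delta x i j ->
  (1 - gamma) * Rabs (psum (fun m => gamma ^ m *
     (sin (2 * PI * orbit_pt b x i m) - sin (2 * PI * orbit_pt b x j m))) n)
  <= 2 * gamma ^ n + tol.
Proof.
  intros [H _]. rewrite !S_fun_Series, <- Series_minus in H by apply ex_series_S_term.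
  apply psum_geom_bound; [lra | intro; apply sin_diff_bound |].
  erewrite Series_ext in H.
  2:{ intro n0. instantiate (1 := fun n0 => - (2 * PI) * (gamma ^ n0 *
     (sin (2 * PI * orbit_pt b x i n0) - sin (2 * PI * orbit_pt b x j n0)))).
      unfold S_term, psi, orbit_pt. ring. }
  rewrite Series_scal_l, Rabs_mult, Rabs_Ropp, (Rabs_right (2 * PI)) in H by (pose proof PI_RGT_0; lra).
  set (s := Series _) in *. pose proof (Rabs_pos s). pose proof PI_enclosure. nra.
Qed.

(** The tolerance [tol / INR b] offsets the factor 1/b in front of the series of S'. *)
Lemma tangent_cos_bound (eps tol x : R) (i j : nat -> nat) (n : nat) :
  tangent b gamma eps (tol / INR b) x i j ->
  (1 - gamma / INR b) * Rabs (psum (fun m => (gamma / INR b) ^ m *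
     (cos (2 * PI * orbit_pt b x i m) - cos (2 * PI * orbit_pt b x j m))) n)
  <= 2 * (gamma / INR b) ^ n + tol.
Proof.
  pose proof ratio_lt. pose proof INR_b.
  assert (HD : forall k, ex_series (S_der_term b gamma x k)).
  { intro k. apply (ex_series_geom_bounded (gamma / INR b) ((2 * PI) ^ 2 / INR b));
      [lra | apply S_der_term_bound]. }
  intros [_ H']. rewrite !S_der_Series, <- Series_minus in H' by apply HD.
  apply psum_geom_bound; [lra | intro; apply cos_diff_bound |].
  erewrite Series_ext in H'.
  2:{ intro n0. instantiate (1 := fun n0 => - (2 * PI) ^ 2 / INR b * ((gamma / INR b) ^ n0 *
     (cos (2 * PI * orbit_pt b x i n0) - cos (2 * PI * orbit_pt b x j n0)))).
      unfold S_der_term. ring. }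
  rewrite Series_scal_l, Rabs_mult in H'.
  replace (- (2 * PI) ^ 2 / INR b) with (- ((2 * PI) ^ 2 / INR b)) in H' by (unfold Rdiv; ring).
  assert (HP : 1 <= (2 * PI) ^ 2) by (pose proof PI_enclosure; nra).
  rewrite Rabs_Ropp, Rabs_right in H'
    by (apply Rle_ge, Rlt_le, Rdiv_lt_0_compat; lra).
  set (s := Series _) in *. pose proof (Rabs_pos s).
  apply Rmult_le_compat_r with (r := INR b) in H'; [| lra].
  replace ((2 * PI) ^ 2 / INR b * Rabs s * INR b) with ((2 * PI) ^ 2 * Rabs s) in H' by (field; lra).
  replace (tol / INR b * INR b) with tol in H' by (field; lra). nra.
Qed.

End Tangency.

(** * Measurability *)

Lemma null_set_empty (A : R -> Prop) : (forall x, ~ A x) -> null_set A.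
Proof.
  intros HA e He. exists (fun _ => 0), (fun _ => 0). split; [intro; lra | split].
  - intros x Hx. destruct (HA x Hx).
  - intro N. rewrite sum_eq_R0; [lra |]. intros; lra.
Qed.

Lemma open_interval_open (u v : R) : open_set (fun x => u < x < v).
Proof.
  intros x Hx. assert (Hd : 0 < Rmin (x - u) (v - x)) by (apply Rmin_glb_lt; lra).
  exists (mkposreal _ Hd). intros y Hy. unfold disc in Hy. simpl in Hy.
  pose proof (Rmin_l (x - u) (v - x)). pose proof (Rmin_r (x - u) (v - x)).
  apply Rabs_def2 in Hy. lra.
Qed.

(** The superlevel set is an open set cut off at 0 and 1; letting it reach down to -e makes it open
    and adds points of one interval of length e. *)
Lemma meas_fun01_open (f : R -> R) :
  (forall a, exists U, open_set U /\ forall x, a < f x <-> U x) -> meas_fun01 f.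
Proof.
  intros Hf a. destruct (Hf a) as (U & HU & HfU).
  intros e He. exists (fun x => U x /\ - e < x < 1). split; [| split].
  - intros x [H1 H2]. destruct (HU x H1) as [d1 Hd1].
    destruct (open_interval_open (- e) 1 x H2) as [d2 Hd2].
    assert (Hd : 0 < Rmin d1 d2) by (apply Rmin_glb_lt; [apply d1 | apply d2]).
    exists (mkposreal _ Hd). intros y Hy. unfold disc in Hy. simpl in Hy.
    split; [apply Hd1 | apply Hd2]; unfold disc;
      [pose proof (Rmin_l d1 d2) | pose proof (Rmin_r d1 d2)]; lra.
  - intros x [Hx Hax]. split; [apply HfU, Hax | lra].
  - exists (fun n => match n with O => - e | _ => 0 end), (fun _ => 0).
    split; [intros [|n]; lra | split].
    + intros x [[HUx Hx] Hn]. exists O.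
      destruct (Rle_lt_dec 0 x) as [Hx0 | Hx0]; [| lra].
      destruct Hn. split; [lra | apply HfU, HUx].
    + intro N. induction N as [| N IH]; simpl in *; lra.
Qed.

Definition cell (N : Z) (x : R) : Z := Int_part (IZR N * x).

Lemma cell_spec (N : Z) (x : R) (j : Z) :
  cell N x = j <-> IZR j <= IZR N * x < IZR j + 1.
Proof.
  unfold cell. destruct (base_Int_part (IZR N * x)) as [H1 H2]. split.
  - intros <-. lra.
  - intros [H3 H4]. symmetry. apply Int_part_spec. lra.
Qed.

Lemma cell_range (N : Z) (x : R) : (0 < N)%Z -> 0 <= x < 1 -> (0 <= cell N x < N)%Z.
Proof.
  intros HN Hx. apply IZR_lt in HN.
  destruct (proj1 (cell_spec N x _) eq_refl) as [H1 H2]. split.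
  - apply Z.lt_succ_r, lt_IZR. rewrite succ_IZR. nra.
  - apply lt_IZR. nra.
Qed.

Lemma sum_cover_bound (N : nat) (e : R) (M : nat) :
  0 <= e -> sum_f_R0 (fun n => if Nat.ltb n N then e else 0) M <= INR N * e.
Proof.
  intro He.
  assert (H : sum_f_R0 (fun n => if Nat.ltb n N then e else 0) M <= INR (Nat.min (S M) N) * e).
  { induction M as [| M IH].
    - destruct N as [| N]; simpl; lra.
    - change (sum_f_R0 (fun n => if Nat.ltb n N then e else 0) (S M))
        with (sum_f_R0 (fun n => if Nat.ltb n N then e else 0) M + if Nat.ltb (S M) N then e else 0).
      destruct (Nat.ltb_spec (S M) N) as [Hl | Hl].
      + replace (Nat.min (S (S M)) N) with (S (Nat.min (S M) N)) by lia. rewrite S_INR. lra.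
      + replace (Nat.min (S (S M)) N) with (Nat.min (S M) N) by lia. lra. }
  eapply Rle_trans; [exact H |]. apply Rmult_le_compat_r; [exact He | apply le_INR; lia].
Qed.

Lemma meas_fun01_cell (N : Z) (F : Z -> R) : (0 < N)%Z -> meas_fun01 (fun x => F (cell N x)).
Proof.
  intros HN a e He. pose proof (IZR_lt _ _ HN) as HNr.
  (* Each half-open cell is made open by an extension of length h to the left; the N extensions have
     total length e. *)
  set (h := e / IZR N). assert (Hh : 0 < h) by (apply Rdiv_lt_0_compat; lra).
  exists (fun x => exists j, (0 <= j < N)%Z /\ a < F j /\ IZR j / IZR N - h < x < (IZR j + 1) / IZR N).
  split; [| split].
  - intros x (j & Hj & Ha & Hx).
    destruct (open_interval_open _ _ x Hx) as [d Hd]. exists d. intros y Hy. exists j.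
    split; [exact Hj | split; [exact Ha | apply Hd, Hy]].
  - intros x [Hx Ha]. exists (cell N x). split; [apply cell_range; assumption |].
    split; [exact Ha |].
    destruct (proj1 (cell_spec N x _) eq_refl) as [H1 H2]. split.
    + apply Rlt_le_trans with (IZR (cell N x) / IZR N); [lra |].
      apply Rmult_le_reg_l with (IZR N); [lra |].
      replace (IZR N * (IZR (cell N x) / IZR N)) with (IZR (cell N x)) by (field; lra). exact H1.
    + apply Rmult_lt_reg_l with (IZR N); [lra |].
      replace (IZR N * ((IZR (cell N x) + 1) / IZR N)) with (IZR (cell N x) + 1) by (field; lra). exact H2.
  - exists (fun n => if Nat.ltb n (Z.to_nat N) then INR n / IZR N - h else 0),
           (fun n => if Nat.ltb n (Z.to_nat N) then INR n / IZR N else 0).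
    split; [intro n; destruct Nat.ltb; lra | split].
    + intros x [(j & Hj & Ha & Hx) Hn]. exists (Z.to_nat j).
      destruct (Nat.ltb_spec (Z.to_nat j) (Z.to_nat N)) as [_ | Hl]; [| lia].
      rewrite INR_IZR_INZ, Z2Nat.id by lia. split; [lra |].
      destruct (Rle_lt_dec x (IZR j / IZR N)) as [Hle | Hlt]; [exact Hle |]. destruct Hn.
      assert (H1 : IZR j < IZR N * x).
      { replace (IZR j) with (IZR N * (IZR j / IZR N)) by (field; lra).
        apply Rmult_lt_compat_l; [exact HNr | exact Hlt]. }
      assert (H2 : IZR N * x < IZR j + 1).
      { replace (IZR j + 1) with (IZR N * ((IZR j + 1) / IZR N)) by (field; lra).
        apply Rmult_lt_compat_l; lra. }
      replace (cell N x) with j by (symmetry; apply cell_spec; lra).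
      assert (Hj0 : 0 <= IZR j) by (apply IZR_le; lia).
      assert (Hj1 : IZR j + 1 <= IZR N) by (rewrite <- plus_IZR; apply IZR_le; lia).
      split; [nra | exact Ha].
    + intro M. rewrite (sum_eq _ (fun n => if Nat.ltb n (Z.to_nat N) then h else 0)).
      * eapply Rle_trans; [apply sum_cover_bound; lra |].
        rewrite INR_IZR_INZ, Z2Nat.id by lia. unfold h. right. field. lra.
      * intros n _. destruct Nat.ltb; ring.
Qed.

(** * Words of length one *)

Lemma words_1 (b : nat) : words b 1 = map (fun d => [d]) (seq 0 b).
Proof.
  unfold words. induction (seq 0 b) as [| d l IH]; [reflexivity |]. simpl in *. rewrite IH. reflexivity.
Qed.

Lemma word_1 (b : nat) (u : list nat) : word b 1 u <-> exists d, (d < b)%nat /\ u = [d].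
Proof.
  split.
  - intros [Hl Hf]. destruct u as [| d [| e u]]; try discriminate.
    exists d. split; [inversion Hf; assumption | reflexivity].
  - intros (d & Hd & ->). split; [reflexivity | constructor; [exact Hd | constructor]].
Qed.

Definition sumR (l : list nat) (f : nat -> R) : R := fold_right Rplus 0 (map f l).

Lemma xu_1 (b : nat) (x : R) (d : nat) : (0 < b)%nat -> xu b x [d] = (x + INR d) / INR b.
Proof.
  intro Hb. apply lt_INR in Hb. simpl in Hb. unfold xu. simpl. field. lra.
Qed.

Lemma xu_1_range (b : nat) (x : R) (d : nat) :
  (d < b)%nat -> 0 <= x < 1 -> 0 <= xu b x [d] < 1.
Proof.
  intros Hd Hx. rewrite xu_1 by lia.
  assert (Hb : 0 < INR b) by (apply (lt_INR 0); lia).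
  apply le_INR in Hd. rewrite S_INR in Hd. pose proof (pos_INR d).
  split; [apply Rdiv_le_0_compat; lra |].
  apply Rmult_lt_reg_r with (INR b); [lra |]. unfold Rdiv. rewrite Rmult_assoc, Rinv_l by lra. lra.
Qed.

Lemma Sigma_1_le (b : nat) (V : R -> list nat -> list nat -> R) (omega : R -> R) (x M : R) :
  0 <= M ->
  (forall k, (k < b)%nat ->
     omega x / omega (xu b x [k]) * sumR (seq 0 b) (fun l => V x [k] [l]) <= M) ->
  Sigma b 1 V omega x <= M.
Proof.
  intros HM H. unfold Sigma. rewrite words_1, map_map.
  assert (Hin : forall k, In k (seq 0 b) -> (k < b)%nat) by (intros k Hk; apply in_seq in Hk; lia).
  (* Occurrences 1 and 3 are the range of the row index. Occurrence 2 is the range of the inner sum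
     and stays fixed during the induction. *)
  revert Hin. generalize (seq 0 b) at 1 3. intro l.
  induction l as [| k l IH]; intro Hin; simpl; [exact HM |].
  apply Rmax_lub; [| apply IH; intros; apply Hin; right; assumption].
  rewrite map_map. apply H, Hin. left. reflexivity.
Qed.

(** Strict inequality for the infimum sigma(q) means that a single pair of weight and testing
    function already stays below. *)
Definition sigma_below (b : nat) (gamma : R) : Prop :=
  exists q : nat, (1 <= q)%nat /\
    exists (omega : R -> R) (V : R -> list nat -> list nat -> R),
      weight_fun omega /\ admissible b gamma q V /\
      esssup_lt (Sigma b q V omega) ((INR b * gamma) ^ q).

(** The bound holds at every point of [0,1), so the exceptional null set is empty. *)
Lemma sigma_1_lt (b : nat) (gamma M : R) (omega : R -> R) (V : R -> list nat -> list nat -> R) :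
  weight_fun omega -> admissible b gamma 1 V -> 0 <= M < INR b * gamma ->
  (forall x k, 0 <= x < 1 -> (k < b)%nat ->
     omega x / omega (xu b x [k]) * sumR (seq 0 b) (fun l => V x [k] [l]) <= M) ->
  sigma_below b gamma.
Proof.
  intros Hw HV HM H. exists 1%nat. split; [lia |]. exists omega, V.
  split; [exact Hw | split; [exact HV |]].
  exists M. split; [rewrite pow_1; lra |]. apply null_set_empty.
  intros x [Hx Hlt]. apply (Rlt_not_le _ _ Hlt).
  apply Sigma_1_le; [lra |]. intros k Hk. apply H; assumption.
Qed.

(** * Large bases *)

Lemma sin_ge_half (t : R) : 1 / 6 <= t <= 5 / 6 -> 1 / 2 <= sin (PI * t).
Proof.
  intro Ht. pose proof PI_enclosure. rewrite <- sin_PI6.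
  destruct (Rle_dec t (1 / 2)) as [H1 | H1].
  - apply sin_incr_1; nra.
  - rewrite <- (sin_PI_x (PI * t)). apply sin_incr_1; nra.
Qed.

(** Here y = pi t is at most 0.53, where y - y^3/6 loses less than five percent of y, and 2.9 < 0.95
    pi. *)
Lemma sin_ge_linear (t : R) : 0 <= t <= 1 / 6 -> 29 / 10 * t <= sin (PI * t).
Proof.
  intro Ht. pose proof PI_enclosure as HP.
  set (y := PI * t). assert (Hy : 0 <= y <= 53 / 100) by (unfold y; nra).
  destruct (sin_bound y 0) as [Hl _]; [lra | lra |].
  unfold sin_approx in Hl. change (2 * 0 + 1)%nat with 1%nat in Hl. unfold sum_f_R0 in Hl.
  rewrite (sin_term_val y 0 1), (sin_term_val y 1 6) in Hl by reflexivity.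
  cbn [Nat.mul Nat.add pow] in Hl.
  assert (y * (y * y) <= y * (53 / 100 * (53 / 100))) by (apply Rmult_le_compat_l; nra).
  assert (3141591 / 1000000 * t <= y) by (unfold y; nra). lra.
Qed.

(** A sine below 1/2 pushes |t| below 1/6, where the linear bound applies. *)
Lemma small_sin_arg (t : R) :
  Rabs t <= 5 / 6 -> Rabs (sin (PI * t)) < 1 / 2 -> 29 / 10 * Rabs t <= Rabs (sin (PI * t)).
Proof.
  assert (H : forall t, 0 <= t <= 5 / 6 -> Rabs (sin (PI * t)) < 1 / 2 ->
                29 / 10 * t <= Rabs (sin (PI * t))).
  { clear t. intros t Ht Hs. pose proof (Rle_abs (sin (PI * t))).
    destruct (Rle_dec t (1 / 6)) as [H1 | H1].
    - pose proof (sin_ge_linear t). lra.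
    - pose proof (sin_ge_half t). lra. }
  intros Ht Hs. destruct (Rle_dec 0 t) as [H0 | H0].
  - rewrite Rabs_right in Ht |- * by lra. apply H; lra.
  - rewrite (Rabs_left t) in Ht |- * by lra.
    replace (Rabs (sin (PI * t))) with (Rabs (sin (PI * - t))) in *
      by (rewrite Ropp_mult_distr_r_reverse, sin_neg, Rabs_Ropp; reflexivity).
    apply H; lra.
Qed.

(** The sine is small only near the ends of the range of |k - l|, where the linear bound applies;
    elsewhere it is at least 1/2, which exceeds 2.9/b from b = 6 on. *)
Lemma sin_digit_gap (b k l : nat) :
  (6 <= b)%nat -> (k < b)%nat -> (l < b)%nat -> k <> l ->
  29 / 10 / INR b <= Rabs (sin (PI * ((INR k - INR l) / INR b))).
Proof.
  assert (H : forall m, (6 <= b)%nat -> (0 < m < b)%nat ->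
             29 / 10 / INR b <= Rabs (sin (PI * (INR m / INR b)))).
  { intros m Hb Hm. apply (le_INR 6) in Hb. simpl in Hb.
    destruct Hm as [Hm1 Hm2]. apply (le_INR 1) in Hm1. simpl in Hm1.
    apply le_INR in Hm2. rewrite S_INR in Hm2.
    set (t := INR m / INR b).
    assert (Ht : / INR b <= t <= 1 - / INR b).
    { unfold t. replace (1 - / INR b) with ((INR b - 1) / INR b) by (field; lra).
      unfold Rdiv. split; [rewrite <- (Rmult_1_l (/ INR b)) at 1 |];
        (apply Rmult_le_compat_r; [left; apply Rinv_0_lt_compat; lra | lra]). }
    assert (Hib : / INR b <= 1 / 6).
    { replace (1 / 6) with (/ 6) by lra. apply Rinv_le_contravar; lra. }
    assert (0 < / INR b) by (apply Rinv_0_lt_compat; lra).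
    eapply Rle_trans; [| apply Rle_abs]. unfold Rdiv at 1.
    destruct (Rle_dec t (1 / 6)) as [H1 | H1].
    - pose proof (sin_ge_linear t). lra.
    - destruct (Rle_dec t (5 / 6)) as [H2 | H2].
      + pose proof (sin_ge_half t). lra.
      + rewrite <- (sin_PI_x (PI * t)). replace (PI - PI * t) with (PI * (1 - t)) by ring.
        pose proof (sin_ge_linear (1 - t)). lra. }
  intros Hb Hk Hl Hkl.
  destruct (Nat.lt_total k l) as [Hlt | [E | Hlt]]; [| lia |].
  - rewrite <- Rabs_Ropp, <- sin_neg.
    replace (- (PI * ((INR k - INR l) / INR b))) with (PI * (INR (l - k) / INR b))
      by (rewrite minus_INR by lia; unfold Rdiv; ring).
    apply H; lia.
  - replace (INR k - INR l) with (INR (k - l)) by (rewrite minus_INR by lia; ring).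
    apply H; lia.
Qed.

(** * Tangency seen at the first digit *)

Section FirstDigit.
Context (b : nat) (gamma : R).
Hypothesis hb : (2 <= b)%nat.
Hypothesis hg : 0 < gamma < 1.

(** The partial sum bounds at depth 1, with differences of sines and cosines written as products;
    the factor 2 of these formulas halves the tolerance. *)
Lemma first_digit_bounds (tol x : R) (k l : nat) :
  E_set b gamma 1 x tol (tol / INR b) [k] [l] ->
  (1 - gamma) * (Rabs (sin (PI * ((INR k - INR l) / INR b))) *
                 Rabs (cos (PI * ((2 * x + INR k + INR l) / INR b)))) <= gamma + tol / 2 /\
  (1 - gamma / INR b) * (Rabs (sin (PI * ((INR k - INR l) / INR b))) *
                 Rabs (sin (PI * ((2 * x + INR k + INR l) / INR b)))) <= gamma / INR b + tol / 2.
Proof.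
  assert (Hb0 : 0 < INR b) by (apply (lt_INR 0); lia).
  intros (_ & _ & u & v & _ & _ & Ht).
  pose proof (tangent_sin_bound b gamma hb hg _ _ _ _ _ 1 Ht) as H1.
  pose proof (tangent_cos_bound b gamma hb hg _ _ _ _ _ 1 Ht) as H2.
  unfold psum in H1, H2. rewrite !orbit_pt_0 in H1, H2 by exact hb.
  cbn [concat_seq length nth Nat.ltb Nat.leb] in H1, H2.
  rewrite !pow_1, pow_O, !Rplus_0_l, Rmult_1_l in H1, H2.
  change (concat_seq [k] u 0) with k in H1, H2. change (concat_seq [l] v 0) with l in H1, H2.
  rewrite form4 in H1. rewrite form2 in H2.
  replace ((2 * PI * ((x + INR k) / INR b) - 2 * PI * ((x + INR l) / INR b)) / 2)
    with (PI * ((INR k - INR l) / INR b)) in H1, H2 by (field; lra).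
  replace ((2 * PI * ((x + INR k) / INR b) + 2 * PI * ((x + INR l) / INR b)) / 2)
    with (PI * ((2 * x + INR k + INR l) / INR b)) in H1, H2 by (field; lra).
  rewrite !Rabs_mult in H1, H2. rewrite (Rabs_right 2) in H1 by lra.
  rewrite (Rabs_left (-2)) in H2 by lra. lra.
Qed.

(** Squaring and adding the two inequalities eliminates x, since the squares of cosine and sine of
    the mean angle add up to 1. The result contradicts the lower bound 2.9/b for |sin(pi (k -
    l)/b)|. *)
Lemma no_tangency_large_base (x : R) (k l : nat) :
  (7 <= b)%nat -> INR b * gamma <= 2 ->
  E_set b gamma 1 x (1 / (50 * INR b)) (1 / (50 * INR b) / INR b) [k] [l] -> k = l.
Proof.
  intros Hb7 Hbg HE.
  assert (HB : 7 <= INR b) by (apply (le_INR 7) in Hb7; simpl in Hb7; lra).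
  destruct (Nat.eq_dec k l) as [E | Hne]; [exact E | exfalso].
  destruct (first_digit_bounds _ _ _ _ HE) as [H1 H2].
  destruct HE as (Hk & Hl & _).
  apply word_1 in Hk as (k' & Hk & Ek). injection Ek as <-.
  apply word_1 in Hl as (l' & Hl & El). injection El as <-.
  pose proof (sin_digit_gap b k l ltac:(lia) Hk Hl Hne) as Hs.
  set (s := Rabs (sin (PI * ((INR k - INR l) / INR b)))) in *.
  pose proof (sin2_cos2 (PI * ((2 * x + INR k + INR l) / INR b))) as Hsc. unfold Rsqr in Hsc.
  set (B := INR b) in *.
  set (c' := cos _) in *. set (s' := sin (PI * ((2 * x + INR k + INR l) / B))) in *.
  pose proof (Rabs_pos c') as Hc0. pose proof (Rabs_pos s') as Hs0.
  assert (Hsq : Rabs s' * Rabs s' + Rabs c' * Rabs c' = 1).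
  { rewrite <- !Rabs_mult, !Rabs_right by nra. exact Hsc. }
  set (p := Rabs c') in *. set (r := Rabs s') in *.
  assert (Hsb : 29 / 10 <= B * s).
  { replace (29 / 10) with (B * (29 / 10 / B)) by (field; lra). apply Rmult_le_compat_l; lra. }
  assert (HgB : gamma / B * B = gamma) by (field; lra).
  assert (E1 : B * (1 / (50 * B)) = 1 / 50) by (field; lra).
  set (t := 1 / (50 * B)) in *.
  assert (Ht : 0 < t) by (unfold t; apply Rdiv_lt_0_compat; lra).
  assert (Hg2 : gamma / B <= 2 / 49).
  { apply Rmult_le_reg_r with B; [lra |]. rewrite HgB. nra. }
  assert (Hg27 : gamma <= 2 / 7) by nra.
  (* Scaled by [b - 2], the two components of [2.9] are at most [2.01] and [0.3]. *)
  assert (G1 : (B - 2) * (s * p) <= 201 / 100).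
  { apply Rle_trans with (B * ((1 - gamma) * (s * p))).
    - assert (0 <= s * p) by (apply Rmult_le_pos; [apply Rabs_pos | lra]). nra.
    - apply Rle_trans with (B * (gamma + t / 2)); [apply Rmult_le_compat_l; lra | lra]. }
  assert (G2 : (B - 2) * (s * r) <= 30 / 100).
  { apply Rle_trans with (B * ((1 - gamma / B) * (s * r))).
    - assert (0 <= s * r) by (apply Rmult_le_pos; [apply Rabs_pos | lra]).
      assert (B * (1 - gamma / B) = B - gamma) by lra. nra.
    - apply Rle_trans with (B * (gamma / B + t / 2)); [apply Rmult_le_compat_l; lra | lra]. }
  (* 145/70 is 2.9 times 5/7, and b - 2 >= 5b/7 from b = 7 on. *)
  assert (G3 : 145 / 70 <= (B - 2) * s).
  { apply Rmult_le_reg_l with B; [lra |]. nra. }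
  assert (G4 : ((B - 2) * s) * ((B - 2) * s)
     = ((B - 2) * (s * r)) * ((B - 2) * (s * r)) + ((B - 2) * (s * p)) * ((B - 2) * (s * p))).
  { transitivity (((B - 2) * s) * ((B - 2) * s) * (r * r + p * p)); [rewrite Hsq |]; ring. }
  assert (0 <= s) by apply Rabs_pos.
  assert (0 <= (B - 2) * (s * r)) by (apply Rmult_le_pos; nra).
  assert (0 <= (B - 2) * (s * p)) by (apply Rmult_le_pos; nra).
  nra.
Qed.

End FirstDigit.

(** * Counting letters with a small sine *)

Lemma filter_length_le (p : nat -> bool) (lo hi : R) (n : nat) :
  lo <= hi -> (forall m, (m < n)%nat -> p m = true -> lo <= INR m <= hi) ->
  INR (length (filter p (seq 0 n))) <= hi - lo + 1.
Proof.
  intros Hlh Hp.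
  (* For the induction the interval is truncated at the last index inspected; the first alternative
     says that nothing has been selected yet. *)
  assert (H : forall m, (m <= n)%nat -> INR (length (filter p (seq 0 m))) <= 0 \/
            INR (length (filter p (seq 0 m))) <= Rmin (INR m - 1) hi - lo + 1).
  { induction m as [| m IH]; intro Hm; [left; simpl; lra |].
    rewrite seq_S, filter_app, length_app, plus_INR. simpl (0 + m)%nat. cbn [filter].
    specialize (IH ltac:(lia)). rewrite S_INR.
    destruct (p m) eqn:Epm; cbn [length INR]; unfold Rmin in *;
      [specialize (Hp m ltac:(lia) Epm) |];
      repeat destruct Rle_dec; lra. }
  destruct (H n (le_n n)) as [H0 | H0]; [lra |].
  pose proof (Rmin_r (INR n - 1) hi). lra.
Qed.

(** A predicate of period b holds equally often on any b consecutive integers: moving the window by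
    one exchanges an end point for a congruent one. *)
Lemma filter_periodic_shift (q : Z -> bool) (b : nat) (p : nat) (a : Z) :
  (forall z, q (z + Z.of_nat b)%Z = q z) ->
  length (filter (fun l => q (a + Z.of_nat l)%Z) (seq 0 b))
  = length (filter (fun l => q (a - Z.of_nat p + Z.of_nat l)%Z) (seq 0 b)).
Proof.
  intro Hq.
  assert (H1 : forall a, length (filter (fun l => q (a + Z.of_nat l)%Z) (seq 0 b))
             = length (filter (fun l => q (a - 1 + Z.of_nat l)%Z) (seq 0 b))).
  { clear a. intro a. destruct b as [| c]; [reflexivity |].
    rewrite (seq_S c 0) at 1. rewrite filter_app, length_app. simpl (0 + c)%nat.
    cbn [seq]. rewrite <- seq_shift. cbn [filter].
    assert (Hm : length (filter (fun l => q (a - 1 + Z.of_nat l)%Z) (map S (seq 0 c)))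
               = length (filter (fun l => q (a + Z.of_nat l)%Z) (seq 0 c))).
    { induction (seq 0 c) as [| m l IH]; [reflexivity |]. cbn [map filter].
      replace (a - 1 + Z.of_nat (S m))%Z with (a + Z.of_nat m)%Z by lia.
      destruct q; cbn [length]; rewrite IH; reflexivity. }
    replace (q (a + Z.of_nat c)%Z) with (q (a - 1 + Z.of_nat 0)%Z)
      by (rewrite <- Hq; f_equal; lia).
    destruct q; cbn [length]; rewrite Hm; lia. }
  revert a. induction p as [| p IH]; intro a.
  - rewrite Z.sub_0_r. reflexivity.
  - rewrite IH, H1. f_equal. apply filter_ext. intro l. f_equal. lia.
Qed.

Definition sin_small (b : nat) (tau y : R) : bool :=
  if Rlt_dec (Rabs (sin (PI * (y / INR b)))) tau then true else false.

(** By periodicity the b consecutive points may be moved around 0, where the linear bound confines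
    those with small sine to radius tau b / 2.9. *)
Lemma sin_small_count (b : nat) (tau y : R) :
  (6 <= b)%nat -> 0 < tau <= 1 / 2 -> 0 <= y ->
  INR (length (filter (fun l => sin_small b tau (y + INR l)) (seq 0 b)))
  <= 2 * (tau * INR b / (29 / 10)) + 1.
Proof.
  intros Hb Ht Hy.
  assert (HB : 6 <= INR b) by (apply (le_INR 6) in Hb; simpl in Hb; lra).
  set (q := fun z : Z => sin_small b tau (y + IZR z)).
  assert (Hq : forall z, q (z + Z.of_nat b)%Z = q z).
  { intro z. unfold q, sin_small. rewrite plus_IZR, <- INR_IZR_INZ.
    replace (PI * ((y + (IZR z + INR b)) / INR b)) with (PI * ((y + IZR z) / INR b) + PI)
      by (field; lra).
    rewrite neg_sin, Rabs_Ropp. reflexivity. }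
  destruct (archimed y) as [A1 A2].
  (* Subtracting [p] leaves points between -b/2 - 1 and b/2, within the 5b/6 that [small_sin_arg]
     allows. *)
  set (p := (Z.to_nat (up y) + Nat.div b 2)%nat).
  rewrite (filter_ext _ (fun l => q (0 + Z.of_nat l)%Z))
    by (intro l; unfold q; rewrite Z.add_0_l, <- INR_IZR_INZ; reflexivity).
  rewrite (filter_periodic_shift q b p 0 Hq).
  assert (Hup : (0 <= up y)%Z) by (apply le_IZR; lra).
  assert (Hp : INR p = IZR (up y) + INR (b / 2)).
  { unfold p. rewrite plus_INR. f_equal. rewrite INR_IZR_INZ, Z2Nat.id by exact Hup. reflexivity. }
  assert (Hh : INR b - 1 <= 2 * INR (b / 2) <= INR b).
  { pose proof (Nat.div_mod_eq b 2). pose proof (Nat.mod_upper_bound b 2 ltac:(lia)).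
    split.
    - assert (H1 : (b <= 2 * (b / 2) + 1)%nat) by lia.
      apply le_INR in H1. rewrite plus_INR, mult_INR in H1. cbn [INR] in H1. lra.
    - assert (H1 : (2 * (b / 2) <= b)%nat) by lia.
      apply le_INR in H1. rewrite mult_INR in H1. cbn [INR] in H1. lra. }
  set (R0 := tau * INR b / (29 / 10)).
  assert (Htb : 0 <= tau * INR b) by (apply Rmult_le_pos; lra).
  assert (HR : 0 <= R0) by (unfold R0; lra).
  replace (2 * R0 + 1) with ((INR p - y + R0) - (INR p - y - R0) + 1) by ring.
  apply filter_length_le; [lra |].
  intros m Hm Hqm. unfold q, sin_small in Hqm. destruct Rlt_dec as [Hlt | _]; [| discriminate].
  rewrite plus_IZR, minus_IZR, <- !INR_IZR_INZ in Hlt.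
  set (w := y + (0 - INR p + INR m)) in *.
  apply le_INR in Hm. rewrite S_INR in Hm. pose proof (pos_INR m).
  assert (Hib : 0 < / INR b) by (apply Rinv_0_lt_compat; lra).
  assert (Hw : Rabs w <= 5 / 6 * INR b).
  { apply Rabs_le. unfold w. lra. }
  assert (Hwb : Rabs (w / INR b) = Rabs w / INR b) by (rewrite Rabs_div, (Rabs_right (INR b)); lra).
  assert (Hw' : Rabs (w / INR b) <= 5 / 6).
  { rewrite Hwb. apply Rmult_le_reg_r with (INR b); [lra |]. unfold Rdiv.
    rewrite (Rmult_assoc (Rabs w)), Rinv_l by lra. lra. }
  pose proof (small_sin_arg (w / INR b) Hw' ltac:(lra)) as Hs.
  assert (HwR : Rabs w <= R0).
  { unfold R0. apply Rmult_le_reg_r with (29 / 10 * / INR b); [nra |].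
    replace (tau * INR b / (29 / 10) * (29 / 10 * / INR b)) with tau by (field; lra).
    rewrite Hwb in Hs. unfold Rdiv in Hs. nra. }
  apply Rabs_le_between in HwR. unfold w in HwR. lra.
Qed.

Lemma sumR_indicator (p : nat -> bool) (l : list nat) :
  sumR l (fun m => if p m then 1 else 0) = INR (length (filter p l)).
Proof.
  unfold sumR. induction l as [| m l IH]; [reflexivity |]. cbn [map fold_right filter].
  rewrite IH. destruct (p m); cbn [length]; [rewrite S_INR |]; lra.
Qed.

Lemma sumR_le (f g : nat -> R) (l : list nat) :
  (forall m, In m l -> f m <= g m) -> sumR l f <= sumR l g.
Proof.
  unfold sumR. induction l as [| m l IH]; intro H; cbn [map fold_right]; [lra |].
  apply Rplus_le_compat; [apply H; left; reflexivity | apply IH; intros; apply H; right; assumption].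
Qed.

Lemma sumR_plus (f g : nat -> R) (l : list nat) :
  sumR l (fun m => f m + g m) = sumR l f + sumR l g.
Proof. unfold sumR. induction l as [| m l IH]; cbn [map fold_right]; lra. Qed.

Lemma diagonal_count (b k : nat) : INR (length (filter (Nat.eqb k) (seq 0 b))) <= 1.
Proof.
  replace 1 with (INR k - INR k + 1) by ring. apply filter_length_le; [lra |].
  intros m _ E. apply Nat.eqb_eq in E. subst. lra.
Qed.

Lemma weight_fun_1 : weight_fun (fun _ => 1).
Proof.
  split; [| split].
  - apply (meas_fun01_cell 1 (fun _ => 1)). lia.
  - intros; lra.
  - exists 1. intros. split; lra.
Qed.

(** * Large bases: the two regimes of b gamma *)

Definition letter (u : list nat) : nat := nth 0 u O.

(** Distinct letters are never tangent, so the identity matrix is admissible; its row sums are 1 < b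
    gamma. *)
Lemma sigma_below_large_base_small_gamma (b : nat) (gamma : R) :
  (7 <= b)%nat -> / INR b < gamma < 1 -> INR b * gamma <= 2 -> sigma_below b gamma.
Proof.
  intros Hb Hg Hbg.
  assert (HB : 7 <= INR b) by (apply (le_INR 7) in Hb; simpl in Hb; lra).
  assert (Hib : 0 < / INR b) by (apply Rinv_0_lt_compat; lra).
  apply (sigma_1_lt b gamma 1 (fun _ => 1)
    (fun _ u v => if Nat.eqb (letter u) (letter v) then 1 else 0)).
  - apply weight_fun_1.
  - split; [| split].
    + intros u v _ _. apply (meas_fun01_cell 1 (fun _ => _)). lia.
    + intros. destruct Nat.eqb; lra.
    + exists (1 / (50 * INR b)), (1 / (50 * INR b) / INR b).
      assert (0 < 1 / (50 * INR b)) by (apply Rdiv_lt_0_compat; lra).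
      split; [lra | split; [apply Rdiv_lt_0_compat; lra |]].
      intros x u v Hx HE. pose proof HE as (Hu & Hv & _).
      apply word_1 in Hu as (k & Hk & ->). apply word_1 in Hv as (l & Hl & ->).
      apply no_tangency_large_base in HE; [| lia | lra | lia | lra]. subst l.
      cbn. rewrite Nat.eqb_refl. lra.
  - split; [lra |]. apply Rmult_lt_reg_l with (/ INR b); [lra |].
    rewrite <- Rmult_assoc, Rinv_l, Rmult_1_l, Rmult_1_r by lra. lra.
  - intros x k _ _. cbn [letter nth]. rewrite (sumR_indicator (Nat.eqb k)).
    pose proof (diagonal_count b k). lra.
Qed.

(** V marks equal letters and pairs with |sin(pi (2x + k + l)/b)| < tau. A row sum is at most the
    diagonal entry plus the count of [sin_small_count]. *)
Lemma sigma_below_large_base_large_gamma (b : nat) (gamma : R) :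
  (6 <= b)%nat -> gamma < 1 -> 2 < INR b * gamma -> sigma_below b gamma.
Proof.
  intros Hb Hg1 Hbg.
  assert (HB : 6 <= INR b) by (apply (le_INR 6) in Hb; simpl in Hb; lra).
  assert (Hg0 : 0 < gamma) by nra.
  assert (Hib : 0 < / INR b) by (apply Rinv_0_lt_compat; lra).
  set (B := INR b) in *.
  (* [tau] is the bound on |sin(pi (2x + k + l)/b)| that the cosine inequality gives with the digit
     gap 2.9/b; [t] is slack that makes it strict. *)
  set (t := 1 / (500 * B)). set (tau := (gamma + t) * B / (29 / 10 * (B - gamma))).
  assert (Ht : 0 < t <= gamma / 1000).
  { unfold t. split; [apply Rdiv_lt_0_compat; lra |].
    apply Rmult_le_reg_r with (1000 * B); [lra |].
    replace (1 / (500 * B) * (1000 * B)) with 2 by (field; lra).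
    replace (gamma / 1000 * (1000 * B)) with (B * gamma) by field. lra. }
  assert (Hden : 0 < 29 / 10 * (B - gamma)) by lra.
  assert (Htau : 0 < tau <= 415 / 1000 * gamma).
  { unfold tau. split; [apply Rdiv_lt_0_compat; nra |].
    apply Rmult_le_reg_r with (29 / 10 * (B - gamma)); [lra |].
    replace ((gamma + t) * B / (29 / 10 * (B - gamma)) * (29 / 10 * (B - gamma)))
      with ((gamma + t) * B) by (field; lra).
    apply Rle_trans with (1001 / 1000 * gamma * B); [nra |].
    replace (415 / 1000 * gamma * (29 / 10 * (B - gamma)))
      with (gamma * (12035 / 10000 * (B - gamma))) by field.
    replace (1001 / 1000 * gamma * B) with (gamma * (1001 / 1000 * B)) by ring.
    apply Rmult_le_compat_l; lra. }
  (* 0.287 exceeds 2 * 0.415 / 2.9. For b gamma <= 3 the count of small sines is below 2, hence at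
     most 1 as an integer; above 3, already 2 + 0.287 b gamma < b gamma. *)
  set (M := if Rle_dec (B * gamma) 3 then 2 else 2 + 287 / 1000 * (B * gamma)).
  apply (sigma_1_lt b gamma M (fun _ => 1)
    (fun x u v => if Nat.eqb (letter u) (letter v) then 1 else
       if sin_small b tau (2 * x + INR (letter u) + INR (letter v)) then 1 else 0)).
  - apply weight_fun_1.
  - split; [| split].
    + intros u v _ _. destruct Nat.eqb; [apply (meas_fun01_cell 1 (fun _ => _)); lia |].
      apply meas_fun01_open. intro a.
      (* An indicator has three kinds of superlevel sets; the middle one is the preimage of an open
         disc under a continuous function. *)
      destruct (Rlt_dec a 0) as [Ha | Ha]; [| destruct (Rlt_dec a 1) as [Ha1 | Ha1]].
      * exists (fun _ => True). split.
        -- intros x _. exists (mkposreal 1 Rlt_0_1). intros y _. exact I.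
        -- intro x. destruct sin_small; split; (exact (fun _ => I) || (intros; lra)).
      * exists (fun x => disc 0 (mkposreal tau (proj1 Htau))
                  (sin (PI * ((2 * x + INR (letter u) + INR (letter v)) / INR b)))).
        split.
        -- apply (proj1 (continuity_P3 (fun x => sin (PI * ((2 * x + INR (letter u) + INR (letter v)) / INR b))))).
           ++ intro x. apply continuity_pt_filterlim.
              apply (ex_derive_continuous (fun x => sin (PI * ((2 * x + INR (letter u) + INR (letter v)) / INR b))) x).
              auto_derive. exact I.
           ++ apply disc_P1.
        -- intro x. unfold disc, sin_small. simpl. rewrite Rminus_0_r.
           destruct Rlt_dec; split; intros; lra.
      * exists (fun _ => False). split.
        -- intros x [].
        -- intro x. destruct sin_small; split; (intros; lra || contradiction).
    + intros. destruct Nat.eqb; [| destruct sin_small]; lra.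
    + set (tol := t / B). exists tol, (tol / B).
      assert (Htol : 0 < tol) by (apply Rdiv_lt_0_compat; lra).
      split; [lra | split; [apply Rdiv_lt_0_compat; lra |]].
      intros x u v Hx HE. pose proof HE as (Hu & Hv & _).
      apply word_1 in Hu as (k & Hk & ->). apply word_1 in Hv as (l & Hl & ->).
      cbn [letter nth]. rewrite (Nat.eqb_sym l k).
      destruct (Nat.eqb_spec k l) as [E | Hne]; [lra |].
      replace (2 * x + INR l + INR k) with (2 * x + INR k + INR l) by ring.
      assert (Hsmall : sin_small b tau (2 * x + INR k + INR l) = true); [| rewrite Hsmall; lra].
      unfold sin_small. destruct Rlt_dec as [_ | Hn]; [reflexivity | destruct Hn].
      destruct (first_digit_bounds b gamma ltac:(lia) ltac:(lra) _ _ _ _ HE) as [_ H2].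
      pose proof (sin_digit_gap b k l Hb Hk Hl Hne) as Hs. fold B in H2, Hs |- *.
      set (s := Rabs (sin (PI * ((INR k - INR l) / B)))) in *.
      set (r := Rabs (sin (PI * ((2 * x + INR k + INR l) / B)))) in *.
      assert (Hr0 : 0 <= r) by apply Rabs_pos.
      assert (Hgb : gamma / B * B = gamma) by (field; lra).
      assert (Htb : tol * B = t) by (unfold tol; field; lra).
      assert (Hsb : 29 / 10 <= s * B).
      { replace (29 / 10) with (29 / 10 / B * B) by (field; lra). apply Rmult_le_compat_r; lra. }
      assert (H3 : (B - gamma) * (s * r) <= gamma + t / 2).
      { apply Rmult_le_compat_r with (r := B) in H2; [| lra]. nra. }
      unfold tau. apply Rmult_lt_reg_r with (29 / 10 * (B - gamma)); [lra |].
      replace ((gamma + t) * B / (29 / 10 * (B - gamma)) * (29 / 10 * (B - gamma)))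
        with ((gamma + t) * B) by (field; lra).
      apply Rle_lt_trans with (s * B * (r * (B - gamma))).
      * assert (0 <= r * (B - gamma)) by (apply Rmult_le_pos; lra). nra.
      * nra.
  - fold B. unfold M. destruct Rle_dec; lra.
  - intros x k Hx Hk. rewrite Rdiv_diag, Rmult_1_l by lra. cbn [letter nth].
    eapply Rle_trans.
    + apply (sumR_le _ (fun l => (if Nat.eqb k l then 1 else 0) +
               (if sin_small b tau (2 * x + INR k + INR l) then 1 else 0))).
      intros l _. destruct Nat.eqb, sin_small; lra.
    + rewrite sumR_plus, !sumR_indicator.
      pose proof (diagonal_count b k).
      pose proof (sin_small_count b tau (2 * x + INR k) Hb ltac:(lra)
        ltac:(pose proof (pos_INR k); lra)) as Hc. fold B in Hc.
      set (c := length (filter (fun l => sin_small b tau (2 * x + INR k + INR l)) (seq 0 b))) in *.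
      assert (Hc' : INR c <= 287 / 1000 * (B * gamma) + 1).
      { assert (Htb : tau * B <= 415 / 1000 * gamma * B) by (apply Rmult_le_compat_r; lra).
        replace (B * gamma) with (gamma * B) by ring. lra. }
      unfold M. destruct Rle_dec as [H3 | H3]; [| lra].
      assert (Hc1 : (c < 2)%nat) by (apply INR_lt; simpl; lra).
      assert (Hc2 : INR c <= 1) by (apply (le_INR c 1); lia). lra.
Qed.

(** * Enclosures in fixed-point arithmetic *)

Definition enclosure : Type := (Z * Z)%type.
Definition fixed_one : Z := 1048576.

(** An enclosure is a ball: centre and radius in units of 2^-20. *)
Definition in_enc (a : enclosure) (r : R) : Prop := Rabs (r * IZR fixed_one - IZR (fst a)) <= IZR (snd a).

Definition badd (a c : enclosure) : enclosure := (fst a + fst c, snd a + snd c)%Z.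
Definition bsub (a c : enclosure) : enclosure := (fst a - fst c, snd a + snd c)%Z.
(** The summand 2 covers the rounding down of centre and radius, each by less than one unit;
    likewise in [bdiv]. *)
Definition bmul (a c : enclosure) : enclosure :=
  (Z.shiftr (fst a * fst c) 20,
   Z.shiftr (Z.abs (fst a) * snd c + Z.abs (fst c) * snd a + snd a * snd c) 20 + 2)%Z.
Definition bdiv (a : enclosure) (k : Z) : enclosure := (fst a / k, snd a / k + 2)%Z.

Lemma fixed_one_val : IZR fixed_one = 1048576.
Proof. reflexivity. Qed.

Lemma in_enc_exact (z : Z) : in_enc (z, 0%Z) (IZR z / IZR fixed_one).
Proof.
  unfold in_enc. cbn [fst snd]. rewrite fixed_one_val.
  replace (IZR z / 1048576 * 1048576 - IZR z) with 0 by field. rewrite Rabs_R0. lra.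
Qed.

Lemma in_enc_1 : in_enc (fixed_one, 0%Z) 1.
Proof. unfold in_enc. cbn [fst snd]. rewrite fixed_one_val. rewrite Rabs_right; lra. Qed.

Lemma in_badd (a c : enclosure) (r s : R) : in_enc a r -> in_enc c s -> in_enc (badd a c) (r + s).
Proof.
  unfold in_enc, badd. cbn [fst snd]. rewrite !plus_IZR. intros Ha Hc.
  apply Rabs_le_between in Ha, Hc. apply Rabs_le. lra.
Qed.

Lemma in_bsub (a c : enclosure) (r s : R) : in_enc a r -> in_enc c s -> in_enc (bsub a c) (r - s).
Proof.
  unfold in_enc, bsub. cbn [fst snd]. rewrite plus_IZR, minus_IZR. intros Ha Hc.
  apply Rabs_le_between in Ha, Hc. apply Rabs_le. lra.
Qed.

Lemma Zdiv_real (z k : Z) : (0 < k)%Z -> IZR z / IZR k - 1 < IZR (z / k) <= IZR z / IZR k.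
Proof.
  intro Hk. pose proof (Z.div_mod z k ltac:(lia)) as E.
  pose proof (Z.mod_pos_bound z k Hk) as [M1 M2].
  apply IZR_lt in Hk, M2. apply IZR_le in M1.
  apply (f_equal IZR) in E. rewrite plus_IZR, mult_IZR in E.
  assert (Eq : IZR z / IZR k = IZR (z / k) + IZR (z mod k) / IZR k) by (rewrite E at 1; field; lra).
  assert (0 <= IZR (z mod k) / IZR k) by (apply Rdiv_le_0_compat; lra).
  assert (IZR (z mod k) / IZR k < 1).
  { apply Rmult_lt_reg_r with (IZR k); [lra |]. unfold Rdiv. rewrite Rmult_assoc, Rinv_l by lra. lra. }
  lra.
Qed.

Lemma shiftr_real (z : Z) : IZR z / IZR fixed_one - 1 < IZR (Z.shiftr z 20) <= IZR z / IZR fixed_one.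
Proof. rewrite Z.shiftr_div_pow2 by lia. apply (Zdiv_real z fixed_one). reflexivity. Qed.

Lemma in_bmul (a c : enclosure) (r s : R) : in_enc a r -> in_enc c s -> in_enc (bmul a c) (r * s).
Proof.
  destruct a as [x e], c as [y f]. unfold in_enc, bmul. cbn [fst snd]. intros Ha Hc.
  pose proof (shiftr_real (x * y)) as H1.
  pose proof (shiftr_real (Z.abs x * f + Z.abs y * e + e * f)) as H2.
  rewrite !plus_IZR, !mult_IZR, !abs_IZR in H2. rewrite mult_IZR in H1. rewrite plus_IZR.
  set (X := IZR x) in *. set (Y := IZR y) in *. set (E := IZR e) in *. set (F := IZR f) in *.
  rewrite fixed_one_val in *.
  set (u := r * 1048576 - X) in *. set (v := s * 1048576 - Y) in *.
  assert (Huv : Rabs (X * v + Y * u + u * v) <= Rabs X * F + Rabs Y * E + E * F).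
  { eapply Rle_trans; [apply Rabs_triang |]. apply Rplus_le_compat.
    - eapply Rle_trans; [apply Rabs_triang |]. rewrite !Rabs_mult.
      apply Rplus_le_compat; apply Rmult_le_compat_l; try apply Rabs_pos; assumption.
    - rewrite Rabs_mult. apply Rmult_le_compat; try apply Rabs_pos; assumption. }
  apply Rabs_le_between in Huv. apply Rabs_le.
  assert (E1 : r * s * 1048576 = (X * Y + (X * v + Y * u + u * v)) / 1048576)
    by (unfold u, v; field).
  rewrite E1. lra.
Qed.

Lemma in_bdiv (a : enclosure) (k : Z) (r : R) : (0 < k)%Z -> in_enc a r -> in_enc (bdiv a k) (r / IZR k).
Proof.
  destruct a as [x e]. unfold in_enc, bdiv. cbn [fst snd]. intros Hk Ha.
  pose proof (Zdiv_real x k Hk) as H1. pose proof (Zdiv_real e k Hk) as H2.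
  apply IZR_lt in Hk. rewrite plus_IZR. apply Rabs_le_between in Ha. apply Rabs_le.
  assert (E : r / IZR k * IZR fixed_one = (r * IZR fixed_one) / IZR k) by (field; lra).
  rewrite E. set (w := r * IZR fixed_one) in *. unfold Rdiv in *.
  assert (0 < / IZR k) by (apply Rinv_0_lt_compat; lra).
  set (ik := / IZR k) in *.
  assert (- (IZR e * ik) <= (w - IZR x) * ik <= IZR e * ik) by nra. lra.
Qed.

(** Horner form [1 - t/k1 (1 - t/k2 (...))] of the Taylor polynomials of sine and cosine. *)
Fixpoint nest (t : enclosure) (ks : list Z) : enclosure :=
  match ks with
  | [] => (fixed_one, 0%Z)
  | k :: ks' => bsub (fixed_one, 0%Z) (bdiv (bmul t (nest t ks')) k)
  end.

Fixpoint nestR (t : R) (ks : list Z) : R :=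
  match ks with
  | [] => 1
  | k :: ks' => 1 - t * nestR t ks' / IZR k
  end.

Lemma in_nest (t : enclosure) (r : R) (ks : list Z) :
  List.Forall (fun k => (0 < k)%Z) ks -> in_enc t r -> in_enc (nest t ks) (nestR r ks).
Proof.
  intros Hk Ht. induction Hk as [| k ks Hk _ IH]; cbn [nest nestR]; [apply in_enc_1 |].
  apply in_bsub; [apply in_enc_1 |]. apply in_bdiv; [exact Hk |]. apply in_bmul; assumption.
Qed.

Definition widen (a : enclosure) (e : Z) : enclosure := (fst a, snd a + e)%Z.

Lemma in_widen (a : enclosure) (e : Z) (r s : R) :
  in_enc a r -> Rabs (s - r) * IZR fixed_one <= IZR e -> in_enc (widen a e) s.
Proof.
  unfold in_enc, widen. cbn [fst snd]. intros Ha Hr. rewrite plus_IZR. rewrite fixed_one_val in *.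
  replace (s * 1048576 - IZR (fst a)) with ((r * 1048576 - IZR (fst a)) + (s - r) * 1048576) by ring.
  eapply Rle_trans; [apply Rabs_triang |].
  rewrite (Rabs_mult (s - r)), (Rabs_right 1048576) by lra. lra.
Qed.

(* Taylor expansion at a quarter of the argument, then two duplications of the angle. *)
Definition sincos (a : enclosure) : enclosure * enclosure :=
  let y := bmul (Z.max 0 (Z.min fixed_one (fst a)), 0%Z) (1647099, 3)%Z in
  let t := bmul y y in
  let s1 := widen (bmul y (nest t [6; 20; 42; 72; 110]%Z)) 1 in
  let c1 := widen (nest t [2; 12; 30; 56; 90]%Z) 1 in
  let p2 := bmul s1 c1 in
  let s2 := badd p2 p2 in
  let q2 := bmul s1 s1 in
  let c2 := bsub (fixed_one, 0%Z) (badd q2 q2) in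
  let p4 := bmul s2 c2 in
  let q4 := bmul s2 s2 in
  let e := (63 * snd a / 10 + 1)%Z in
  (widen (badd p4 p4) e, widen (bsub (fixed_one, 0%Z) (badd q4 q4)) e).

(** The evaluation takes place at the centre, clamped into [0,1] so that a quarter of the angle lies
    in [0, pi/2]; clamping does not move it away from x. The radius enters at the end through the
    Lipschitz constant 2 pi < 63/10. *)
Lemma in_sincos (a : enclosure) (x : R) :
  0 <= x <= 1 -> in_enc a x ->
  in_enc (fst (sincos a)) (sin (2 * PI * x)) /\ in_enc (snd (sincos a)) (cos (2 * PI * x)).
Proof.
  intros Hx Ha. destruct a as [c r]. pose proof PI_enclosure as HP.
  unfold sincos. cbn [fst snd].
  set (c' := Z.max 0 (Z.min fixed_one c)).
  set (x' := IZR c' / IZR fixed_one). set (u := x' * (PI / 2)).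
  assert (Hc' : (0 <= c' <= fixed_one)%Z) by (unfold c', fixed_one; lia).
  assert (Hx' : 0 <= x' <= 1).
  { destruct Hc' as [C1 C2]. apply IZR_le in C1, C2. unfold x'. rewrite fixed_one_val in *. lra. }
  assert (Hxx : Rabs (x - x') * IZR fixed_one <= IZR r).
  { unfold in_enc in Ha. cbn [fst snd] in Ha. unfold x'. rewrite fixed_one_val in *.
    replace (Rabs (x - IZR c' / 1048576) * 1048576) with (Rabs (x * 1048576 - IZR c')).
    2:{ rewrite <- (Rabs_right 1048576) at 3 by lra. rewrite <- Rabs_mult. f_equal. field. }
    eapply Rle_trans; [| exact Ha].
    destruct (Z_lt_le_dec c 0) as [H1 | H1]; [| destruct (Z_lt_le_dec fixed_one c) as [H2 | H2]].
    - replace c' with 0%Z by (unfold c', fixed_one; lia). apply IZR_lt in H1.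
      rewrite !Rabs_right by lra. lra.
    - replace c' with fixed_one by (unfold c', fixed_one in *; lia). apply IZR_lt in H2. rewrite fixed_one_val in *.
      rewrite !Rabs_left1 by lra. lra.
    - replace c' with c by (unfold c'; lia). lra. }
  assert (Hpi : in_enc (1647099, 3)%Z (PI / 2)).
  { unfold in_enc. cbn [fst snd]. rewrite fixed_one_val. apply Rabs_le. lra. }
  assert (Hy : in_enc (bmul (c', 0%Z) (1647099, 3)%Z) u) by (apply in_bmul; [apply in_enc_exact | exact Hpi]).
  set (y := bmul (c', 0%Z) (1647099, 3)%Z) in *.
  assert (Ht : in_enc (bmul y y) (u * u)) by (apply in_bmul; exact Hy).
  set (t := bmul y y) in *.
  assert (Hu : 0 <= u <= PI / 2) by (unfold u; nra).
  assert (Hu16 : u <= 16 / 10) by lra.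
  assert (Hs1 : in_enc (widen (bmul y (nest t [6; 20; 42; 72; 110]%Z)) 1) (sin u)).
  { apply in_widen with (u * nestR (u * u) [6; 20; 42; 72; 110]%Z).
    - apply in_bmul; [exact Hy |]. apply in_nest; [repeat constructor | exact Ht].
    - destruct (sin_taylor_enclosure u ltac:(lra)) as [T1 T2].
      cbn [nestR]. replace (u * _) with (u - u ^ 3 / 6 + u ^ 5 / 120 - u ^ 7 / 5040 + u ^ 9 / 362880
         - u ^ 11 / 39916800) by field.
      (* With u <= 1.6 the remainder is below one unit of 2^-20, the amount added by [widen];
         likewise for the cosine. *)
      assert (u ^ 13 <= (16 / 10) ^ 13) by (apply pow_incr; lra).
      rewrite fixed_one_val, Rabs_right by lra. lra. }
  assert (Hc1 : in_enc (widen (nest t [2; 12; 30; 56; 90]%Z) 1) (cos u)).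
  { apply in_widen with (nestR (u * u) [2; 12; 30; 56; 90]%Z).
    - apply in_nest; [repeat constructor | exact Ht].
    - destruct (cos_taylor_enclosure u Hu) as [T1 T2].
      cbn [nestR].
      match goal with |- Rabs (_ - ?n) * _ <= _ => replace n with (1 - u ^ 2 / 2 + u ^ 4 / 24
         - u ^ 6 / 720 + u ^ 8 / 40320 - u ^ 10 / 3628800) by field end.
      assert (u ^ 12 <= (16 / 10) ^ 12) by (apply pow_incr; lra).
      rewrite fixed_one_val, Rabs_right by lra. lra. }
  set (s1 := widen (bmul y _) 1) in *. set (c1 := widen (nest t [2; 12; 30; 56; 90]%Z) 1) in *.
  assert (Hs2 : in_enc (badd (bmul s1 c1) (bmul s1 c1)) (sin (2 * u))).
  { rewrite sin_2a. replace (2 * sin u * cos u) with (sin u * cos u + sin u * cos u) by ring.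
    apply in_badd; apply in_bmul; assumption. }
  assert (Hc2 : in_enc (bsub (fixed_one, 0%Z) (badd (bmul s1 s1) (bmul s1 s1))) (cos (2 * u))).
  { rewrite cos_2a_sin. replace (2 * sin u * sin u) with (sin u * sin u + sin u * sin u) by ring.
    apply in_bsub; [apply in_enc_1 |]. apply in_badd; apply in_bmul; assumption. }
  set (s2 := badd (bmul s1 c1) (bmul s1 c1)) in *. set (c2 := bsub _ _) in *.
  assert (Hlip : Rabs (2 * PI * x - 2 * PI * x') * IZR fixed_one <= IZR (63 * r / 10 + 1)).
  { rewrite plus_IZR. pose proof (Zdiv_real (63 * r) 10 ltac:(lia)) as Hd.
    rewrite mult_IZR in Hd.
    replace (2 * PI * x - 2 * PI * x') with (2 * PI * (x - x')) by ring.
    rewrite Rabs_mult, (Rabs_right (2 * PI)) by lra. rewrite fixed_one_val in *.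
    pose proof (Rabs_pos (x - x')).
    assert (2 * PI * (Rabs (x - x') * 1048576) <= 63 / 10 * IZR r); [| lra].
    apply Rmult_le_compat; lra. }
  assert (E4 : 2 * PI * x' = 2 * (2 * u)) by (unfold u; field).
  split.
  - apply in_widen with (sin (2 * PI * x')).
    + rewrite E4, sin_2a.
      replace (2 * sin (2 * u) * cos (2 * u)) with (sin (2 * u) * cos (2 * u) + sin (2 * u) * cos (2 * u)) by ring.
      apply in_badd; apply in_bmul; assumption.
    + eapply Rle_trans; [| exact Hlip]. apply Rmult_le_compat_r; [rewrite fixed_one_val; lra | apply sin_lipschitz].
  - apply in_widen with (cos (2 * PI * x')).
    + rewrite E4, cos_2a_sin.
      replace (2 * sin (2 * u) * sin (2 * u)) with (sin (2 * u) * sin (2 * u) + sin (2 * u) * sin (2 * u)) by ring.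
      apply in_bsub; [apply in_enc_1 |]. apply in_badd; apply in_bmul; assumption.
    + eapply Rle_trans; [| exact Hlip]. apply Rmult_le_compat_r; [rewrite fixed_one_val; lra | apply cos_lipschitz].
Qed.

(* Unlike [forallb], stops at the first failure under call by value. *)
Fixpoint all_true {T : Type} (f : T -> bool) (l : list T) : bool :=
  match l with
  | [] => true
  | a :: l' => if f a then all_true f l' else false
  end.

Lemma all_true_In {T : Type} (f : T -> bool) (l : list T) (a : T) :
  all_true f l = true -> In a l -> f a = true.
Proof.
  induction l as [| c l IH]; cbn [all_true In]; [tauto |].
  destruct (f c) eqn:E; [| discriminate]. intros H [<- | Hin]; auto.
Qed.

(** * Branching search for a contradiction to tangency *)

Definition digit_enc (b : nat) (a : enclosure) (d : nat) : enclosure :=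
  bdiv (fst a + Z.of_nat d * fixed_one, snd a)%Z (Z.of_nat b).

Definition digit_trig (b : nat) (a : enclosure) (d : nat) : enclosure * (enclosure * enclosure) :=
  let a' := digit_enc b a d in (a', sincos a').

(** Sixteen fixed-point units, which makes the tolerance an integer in [excluded]. *)
Definition tol : R := 16 / 1048576.

(* Certifies that [2 c^n + tol < (1 - c) |s|] for [c], [c^n], [s] in the enclosures [c], [cn], [s]. *)
Definition excluded (c cn s : enclosure) : bool :=
  (fixed_one * (2 * (fst cn + snd cn) + 16) <?
   Z.max 0 (Z.abs (fst s) - snd s) * (fixed_one - fst c - snd c))%Z.

(** [X], [Y] enclose the current orbit points, [A], [B] the sums of sine and cosine differences so
    far, [gn], [hn] the powers in the tail bounds. All pairs of next digits are explored until one
    of the two inequalities fails on every branch or the fuel runs out. *)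
Fixpoint refute (b : nat) (g h : enclosure) (fuel : nat) (X Y A B gn hn : enclosure) : bool :=
  if excluded g gn A then true else
  if excluded h hn B then true else
  match fuel with
  | O => false
  | S f =>
      let TX := map (digit_trig b X) (seq 0 b) in
      let TY := map (digit_trig b Y) (seq 0 b) in
      let gn' := bmul gn g in
      let hn' := bmul hn h in
      all_true (fun p => all_true (fun r =>
        refute b g h f (fst p) (fst r)
          (badd A (bmul gn (bsub (fst (snd p)) (fst (snd r)))))
          (badd B (bmul hn (bsub (snd (snd p)) (snd (snd r))))) gn' hn') TY) TX
  end.

Definition refute_root (b fuel : nat) (g x : enclosure) (k l : nat) : bool :=
  let h := bdiv g (Z.of_nat b) in
  let p := digit_trig b x k in
  let r := digit_trig b x l in
  refute b g h fuel (fst p) (fst r) (bsub (fst (snd p)) (fst (snd r)))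
    (bsub (snd (snd p)) (snd (snd r))) g h.

(** When the search fails on a box of values of gamma and x, the wider side is halved and both
    halves are searched. *)
Fixpoint refute_box (b fuel bisections : nat) (g x : enclosure) (k l : nat) : bool :=
  if refute_root b fuel g x k l then true else
  match bisections with
  | O => false
  | S m =>
      if (snd g <=? snd x)%Z then
        let r := (snd x / 2 + 1)%Z in
        if refute_box b fuel m g (fst x - r, r)%Z k l
        then refute_box b fuel m g (fst x + r, r)%Z k l else false
      else
        let r := (snd g / 2 + 1)%Z in
        if refute_box b fuel m (fst g - r, r)%Z x k l
        then refute_box b fuel m (fst g + r, r)%Z x k l else false
  end.

Lemma in_digit_enc (b : nat) (a : enclosure) (d : nat) (y : R) :
  (2 <= b)%nat -> in_enc a y -> in_enc (digit_enc b a d) ((y + INR d) / INR b).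
Proof.
  intros Hb Ha. unfold digit_enc. rewrite (INR_IZR_INZ b). apply in_bdiv; [lia |].
  unfold in_enc in *. cbn [fst snd]. rewrite plus_IZR, mult_IZR, INR_IZR_INZ.
  replace ((y + IZR (Z.of_nat d)) * IZR fixed_one - (IZR (fst a) + IZR (Z.of_nat d) * IZR fixed_one))
    with (y * IZR fixed_one - IZR (fst a)) by ring. exact Ha.
Qed.

Lemma excluded_sound (c cn s : enclosure) (gamma gp sum : R) :
  gamma <= 1 -> in_enc c gamma -> in_enc cn gp -> in_enc s sum -> excluded c cn s = true ->
  ~ (1 - gamma) * Rabs sum <= 2 * gp + tol.
Proof.
  destruct c as [c ec], cn as [p ep], s as [s es].
  unfold in_enc, excluded. cbn [fst snd]. intros Hg Hc Hp Hs H Hle.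
  apply Z.ltb_lt, IZR_lt in H.
  rewrite !mult_IZR, plus_IZR, mult_IZR, plus_IZR, !minus_IZR in H.
  set (L := IZR (Z.max 0 (Z.abs s - es))) in *.
  assert (HL0 : 0 <= L) by (apply IZR_le; lia).
  apply Rabs_le_between in Hc, Hp.
  assert (HL : L <= Rabs sum * 1048576).
  { assert (HL' : L = Rmax 0 (Rabs (IZR s) - IZR es)).
    { unfold L. rewrite <- abs_IZR, <- minus_IZR. unfold Rmax. destruct Rle_dec as [H1 | H1].
      - apply le_IZR in H1. rewrite Z.max_r by exact H1. reflexivity.
      - apply Rnot_le_lt, lt_IZR in H1. rewrite Z.max_l by lia. reflexivity. }
    rewrite HL'. apply Rmax_lub; [pose proof (Rabs_pos sum); lra |].
    replace (Rabs sum * 1048576) with (Rabs (sum * 1048576))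
      by (rewrite Rabs_mult, (Rabs_right 1048576); lra).
    pose proof (Rabs_triang_inv (IZR s) (sum * 1048576)) as Ht.
    rewrite (Rabs_minus_sym (IZR s)) in Ht. rewrite fixed_one_val in Hs. lra. }
  rewrite fixed_one_val in *. unfold tol in Hle.
  set (K := 1048576 - IZR c - IZR ec) in *.
  assert (HK : K <= (1 - gamma) * 1048576) by (unfold K; lra).
  assert (Hrhs : 2 * gp * 1048576 + 16 <= 2 * (IZR p + IZR ep) + 16) by lra.
  (* A wide enclosure can make [K] negative; the left side is then nonpositive. *)
  assert (HKL : L * K <= Rabs sum * 1048576 * ((1 - gamma) * 1048576)).
  { destruct (Rle_dec 0 K) as [K0 | K0].
    - apply Rmult_le_compat; assumption.
    - assert (0 <= Rabs sum * 1048576 * ((1 - gamma) * 1048576)).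
      { pose proof (Rabs_pos sum). apply Rmult_le_pos; lra. }
      nra. }
  nra.
Qed.

(** * Certified regions without tangency *)

Section Refutation.
Context (b : nat) (gamma : R) (X Y : nat -> R).
Hypothesis hb : (2 <= b)%nat.
Hypothesis hg : 0 < gamma < 1.
Hypothesis X_step : forall n, exists d, (d < b)%nat /\ X (S n) = (X n + INR d) / INR b.
Hypothesis Y_step : forall n, exists d, (d < b)%nat /\ Y (S n) = (Y n + INR d) / INR b.
Hypothesis X_range : forall n, 0 <= X n <= 1.
Hypothesis Y_range : forall n, 0 <= Y n <= 1.

Let sin_sum : nat -> R :=
  psum (fun m => gamma ^ m * (sin (2 * PI * X m) - sin (2 * PI * Y m))).
Let cos_sum : nat -> R :=
  psum (fun m => (gamma / INR b) ^ m * (cos (2 * PI * X m) - cos (2 * PI * Y m))).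

Hypothesis sin_sum_le : forall n, (1 - gamma) * Rabs (sin_sum n) <= 2 * gamma ^ n + tol.
Hypothesis cos_sum_le : forall n,
  (1 - gamma / INR b) * Rabs (cos_sum n) <= 2 * (gamma / INR b) ^ n + tol.

(** Orbits of tangent sequences satisfy both inequalities at every depth, so the branch that follows
    their digits is never excluded. *)
Lemma refute_sound (g h : enclosure) (fuel n : nat) (x y A B gn hn : enclosure) :
  in_enc g gamma -> in_enc h (gamma / INR b) ->
  in_enc x (X n) -> in_enc y (Y n) ->
  in_enc A (sin_sum (S n)) -> in_enc B (cos_sum (S n)) ->
  in_enc gn (gamma ^ S n) -> in_enc hn ((gamma / INR b) ^ S n) ->
  refute b g h fuel x y A B gn hn = false.
Proof.
  intros Hg Hh. pose proof (ratio_range b gamma hb hg) as Hr.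
  revert n x y A B gn hn.
  induction fuel as [| fuel IH]; intros n x y A B gn hn Hx Hy HA HB Hgn Hhn; cbn [refute];
    (destruct (excluded g gn A) eqn:EA;
     [exfalso; apply (excluded_sound _ _ _ gamma _ _ ltac:(lra) Hg Hgn HA EA), sin_sum_le |]);
    (destruct (excluded h hn B) eqn:EB;
     [exfalso; apply (excluded_sound _ _ _ (gamma / INR b) _ _ ltac:(lra) Hh Hhn HB EB), cos_sum_le |]).
  - reflexivity.
  - match goal with |- ?t = false => destruct t eqn:E; [exfalso | reflexivity] end.
    destruct (X_step n) as (d & Hd & EX). destruct (Y_step n) as (e & He & EY).
    assert (Dd : In (digit_trig b x d) (map (digit_trig b x) (seq 0 b)))
      by (apply in_map, in_seq; lia).
    assert (De : In (digit_trig b y e) (map (digit_trig b y) (seq 0 b)))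
      by (apply in_map, in_seq; lia).
    pose proof (all_true_In _ _ _ E Dd) as E1. cbv beta in E1.
    pose proof (all_true_In _ _ _ E1 De) as E2. cbv beta in E2.
    assert (HX : in_enc (digit_enc b x d) (X (S n))) by (rewrite EX; apply in_digit_enc; assumption).
    assert (HY : in_enc (digit_enc b y e) (Y (S n))) by (rewrite EY; apply in_digit_enc; assumption).
    destruct (in_sincos _ _ (X_range (S n)) HX) as [SX CX].
    destruct (in_sincos _ _ (Y_range (S n)) HY) as [SY CY].
    rewrite (IH (S n)) in E2; [discriminate | exact HX | exact HY | | | |].
    + apply in_badd; [exact HA |]. apply in_bmul; [exact Hgn |]. apply in_bsub; assumption.
    + apply in_badd; [exact HB |]. apply in_bmul; [exact Hhn |]. apply in_bsub; assumption.
    + change (gamma ^ S (S n)) with (gamma * gamma ^ S n). rewrite Rmult_comm.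
      apply in_bmul; assumption.
    + change ((gamma / INR b) ^ S (S n)) with (gamma / INR b * (gamma / INR b) ^ S n).
      rewrite Rmult_comm. apply in_bmul; assumption.
Qed.

End Refutation.

Lemma refute_root_sound (b fuel : nat) (gamma x : R) (g xb : enclosure) (k l : nat) :
  (2 <= b)%nat -> 0 < gamma < 1 -> 0 <= x <= 1 -> in_enc g gamma -> in_enc xb x ->
  E_set b gamma 1 x tol (tol / INR b) [k] [l] ->
  refute_root b fuel g xb k l = false.
Proof.
  intros Hb Hg Hx Hgb Hxb (Hk & Hl & u & v & Hu & Hv & Ht).
  apply word_1 in Hk as (k' & Hk & E). injection E as <-.
  apply word_1 in Hl as (l' & Hl & E). injection E as <-.
  assert (Hseq : forall c w, (c < b)%nat -> digit_seq b w -> digit_seq b (concat_seq [c] w)).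
  { intros c w Hc Hw [| n]; [exact Hc | apply Hw]. }
  set (i := concat_seq [k] u) in *. set (j := concat_seq [l] v) in *.
  assert (Hi : digit_seq b i) by (apply Hseq; assumption).
  assert (Hj : digit_seq b j) by (apply Hseq; assumption).
  assert (Hrange : forall w, digit_seq b w -> forall n, 0 <= orbit_pt b x w n <= 1).
  { intros w Hw. induction n as [| n IH].
    - rewrite orbit_pt_0 by exact Hb. apply digit_step_range; auto.
    - rewrite orbit_pt_S by exact Hb. apply digit_step_range; auto. }
  assert (Hstep : forall w, digit_seq b w -> forall n, exists d, (d < b)%nat /\
            orbit_pt b x w (S n) = (orbit_pt b x w n + INR d) / INR b).
  { intros w Hw n. exists (w (S n)). split; [apply Hw | apply orbit_pt_S, Hb]. }
  assert (HX : in_enc (digit_enc b xb k) (orbit_pt b x i 0)).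
  { rewrite orbit_pt_0 by exact Hb. apply in_digit_enc; assumption. }
  assert (HY : in_enc (digit_enc b xb l) (orbit_pt b x j 0)).
  { rewrite orbit_pt_0 by exact Hb. apply in_digit_enc; assumption. }
  destruct (in_sincos _ _ (Hrange i Hi 0%nat) HX) as [SX CX].
  destruct (in_sincos _ _ (Hrange j Hj 0%nat) HY) as [SY CY].
  assert (Hh : in_enc (bdiv g (Z.of_nat b)) (gamma / INR b)).
  { rewrite INR_IZR_INZ. apply in_bdiv; [lia | exact Hgb]. }
  apply (refute_sound b gamma (orbit_pt b x i) (orbit_pt b x j)) with (n := O); auto.
  - intro n. apply (tangent_sin_bound b gamma Hb Hg _ _ _ _ _ n Ht).
  - intro n. apply (tangent_cos_bound b gamma Hb Hg _ _ _ _ _ n Ht).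
  - cbn [psum]. rewrite pow_O, Rplus_0_l, Rmult_1_l. apply in_bsub; assumption.
  - cbn [psum]. rewrite pow_O, Rplus_0_l, Rmult_1_l. apply in_bsub; assumption.
  - rewrite pow_1. exact Hgb.
  - rewrite pow_1. exact Hh.
Qed.

(** With r the new radius the halves are [c - 2r, c] and [c, c + 2r]; they cover the ball because
    the added 1 keeps 2r >= e despite integer division. *)
Lemma in_enc_bisect (a : enclosure) (r : R) :
  in_enc a r -> in_enc (fst a - (snd a / 2 + 1), snd a / 2 + 1)%Z r \/
                 in_enc (fst a + (snd a / 2 + 1), snd a / 2 + 1)%Z r.
Proof.
  destruct a as [c e]. unfold in_enc. cbn [fst snd]. intro H.
  rewrite minus_IZR, plus_IZR, !plus_IZR.
  pose proof (Zdiv_real e 2 ltac:(lia)) as Hd.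
  apply Rabs_le_between in H.
  destruct (Rle_dec (r * IZR fixed_one) (IZR c)); [left | right]; apply Rabs_le; lra.
Qed.

Lemma refute_box_sound (b fuel m : nat) (gamma x : R) (g xb : enclosure) (k l : nat) :
  (2 <= b)%nat -> 0 < gamma < 1 -> 0 <= x <= 1 -> in_enc g gamma -> in_enc xb x ->
  E_set b gamma 1 x tol (tol / INR b) [k] [l] ->
  refute_box b fuel m g xb k l = false.
Proof.
  intros Hb Hg Hx Hgb Hxb HE. revert g xb Hgb Hxb.
  induction m as [| m IH]; intros g xb Hgb Hxb; cbn [refute_box];
    rewrite (refute_root_sound b fuel gamma x g xb k l) by assumption; [reflexivity |].
  destruct (snd g <=? snd xb)%Z.
  - destruct (in_enc_bisect xb x Hxb) as [H | H].
    + rewrite (IH g _ Hgb H). reflexivity.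
    + rewrite (IH g _ Hgb H). destruct refute_box; reflexivity.
  - destruct (in_enc_bisect g gamma Hgb) as [H | H].
    + rewrite (IH _ xb H Hxb). reflexivity.
    + rewrite (IH _ xb H Hxb). destruct refute_box; reflexivity.
Qed.

Lemma E_set_sym (b : nat) (gamma : R) (q : nat) (x eps delta : R) (k l : list nat) :
  E_set b gamma q x eps delta k l -> E_set b gamma q x eps delta l k.
Proof.
  intros (Hk & Hl & u & v & Hu & Hv & H1 & H2).
  split; [exact Hl | split; [exact Hk |]]. exists v, u.
  split; [exact Hv | split; [exact Hu |]].
  split; rewrite Rabs_minus_sym; assumption.
Qed.

(** * Certificates on a grid of 64 cells *)

Definition grid : Z := 64.

(* Data for a range [g0/gd < gamma <= g1/gd]. Outside the grid cells [lo <= j < hi] listed for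
   a pair of digits, that pair is not tangent. The weights in [V] of a possibly tangent pair are
   [tn/td] and [td/tn], and the resulting bound on Sigma is [rn/rd]. *)
Record certificate := Certificate {
  g0 : Z; g1 : Z; gd : Z; rn : Z; rd : Z; tn : Z; td : Z;
  windows : list (nat * nat * (Z * Z)) }.

(** An unlisted pair gets an empty window at the right end, so [check_windows] has to refute it on
    all cells. *)
Definition window (c : certificate) (k l : nat) : Z * Z :=
  match find (fun w => Nat.eqb (fst (fst w)) k && Nat.eqb (snd (fst w)) l)%bool (windows c) with
  | Some w => snd w
  | None => (grid, grid)
  end.

Definition may_touch (c : certificate) (j : Z) (k l : nat) : bool :=
  let w := window c (Nat.min k l) (Nat.max k l) in
  ((fst w <=? j) && (j <? snd w))%Z%bool.

(* Entry of [V] times [tn * td]. *)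
Definition weight (c : certificate) (j : Z) (k l : nat) : Z :=
  if Nat.eqb k l then tn c * td c else
  if may_touch c j k l then
    if Bool.eqb (2 * j <? grid)%Z (Nat.ltb k l) then td c * td c else tn c * tn c
  else 0.

Definition row (c : certificate) (b : nat) (j : Z) (k : nat) : Z :=
  fold_right Z.add 0%Z (map (weight c j k) (seq 0 b)).

Definition successor (b : nat) (j : Z) (k : nat) : Z := ((j + Z.of_nat k * grid) / Z.of_nat b)%Z.

Definition lookup (om : list Z) (j : Z) : Z := nth (Z.to_nat j) om 1%Z.

Definition cells : list Z := map Z.of_nat (seq 0 (Z.to_nat grid)).

(* One step towards the largest [omega <= 10^6] with Sigma at most [rn/rd] in every cell. *)
Definition omega_step (c : certificate) (b : nat) (om : list Z) : list Z :=
  map (fun j => fold_right Z.min (lookup om j)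
        (map (fun k => rn c * lookup om (successor b j k) * (tn c * td c) / (rd c * row c b j k))%Z
           (seq 0 b))) cells.

(** The iteration is a search for a suitable weight; [check_omega] certifies its outcome. *)
Definition omega_table (c : certificate) (b : nat) : list Z :=
  Nat.iter 8 (omega_step c b) (map (fun _ => 1000000%Z) cells).

Definition check_omega (c : certificate) (b : nat) (om : list Z) : bool :=
  all_true (fun j => if ((1 <=? lookup om j) && (lookup om j <=? 1000000))%Z%bool then
    all_true (fun k => (lookup om j * row c b j k * rd c <=?
                        rn c * lookup om (successor b j k) * (tn c * td c))%Z) (seq 0 b)
    else false) cells.

Definition refute_cells (c : certificate) (b : nat) (lo hi : Z) (k l : nat) : bool :=
  if (lo <? hi)%Z then
    refute_box b 5 14
      ((g0 c + g1 c) * fixed_one / (2 * gd c), (g1 c - g0 c) * fixed_one / (2 * gd c) + 2)%Z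
      ((lo + hi) * fixed_one / (2 * grid), (hi - lo) * fixed_one / (2 * grid) + 2)%Z k l
  else true.

Definition check_windows (c : certificate) (b : nat) : bool :=
  all_true (fun k => all_true (fun l =>
    if Nat.ltb k l then
      let w := window c k l in
      if refute_cells c b 0 (fst w) k l then refute_cells c b (snd w) grid k l else false
    else true) (seq 0 b)) (seq 0 b).

(** The last inequality reads rn/rd <= b g0/gd; it becomes strict for gamma > g0/gd, which is why
    the ranges are open on the left. *)
Definition check_signs (c : certificate) (b : nat) : bool :=
  ((0 <? gd c) && (0 <? rn c) && (0 <? rd c) && (0 <? tn c) && (0 <? td c) &&
   (rn c * gd c <=? rd c * Z.of_nat b * g0 c))%Z%bool.

Definition check (b : nat) (c : certificate) : bool :=
  if check_signs c b then if check_omega c b (omega_table c b) then check_windows c b else false else false.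

Lemma in_enc_interval (p q d : Z) (r : R) :
  (0 < d)%Z -> IZR p / IZR d <= r <= IZR q / IZR d ->
  in_enc ((p + q) * fixed_one / (2 * d), (q - p) * fixed_one / (2 * d) + 2)%Z r.
Proof.
  intros Hd Hr. unfold in_enc. cbn [fst snd]. rewrite plus_IZR.
  pose proof (Zdiv_real ((p + q) * fixed_one) (2 * d) ltac:(lia)) as H1.
  pose proof (Zdiv_real ((q - p) * fixed_one) (2 * d) ltac:(lia)) as H2.
  rewrite !mult_IZR, plus_IZR in H1. rewrite !mult_IZR, minus_IZR in H2.
  apply IZR_lt in Hd. rewrite fixed_one_val in *.
  set (P := IZR p / IZR d) in *. set (Q := IZR q / IZR d) in *.
  replace ((IZR p + IZR q) * 1048576 / (2 * IZR d)) with ((P + Q) / 2 * 1048576) in H1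
    by (unfold P, Q; field; lra).
  replace ((IZR q - IZR p) * 1048576 / (2 * IZR d)) with ((Q - P) / 2 * 1048576) in H2
    by (unfold P, Q; field; lra).
  apply Rabs_le. lra.
Qed.

Lemma In_cells (j : Z) : (0 <= j < grid)%Z -> In j cells.
Proof.
  intro Hj. unfold cells. apply in_map_iff. exists (Z.to_nat j).
  split; [apply Z2Nat.id; lia |]. apply in_seq. unfold grid in *. lia.
Qed.

(** An inverse branch maps each cell into a single cell. This reduces the bound on Sigma to finitely
    many inequalities between table entries. *)
Lemma cell_successor (b : nat) (x : R) (k : nat) :
  (0 < b)%nat -> cell grid ((x + INR k) / INR b) = successor b (cell grid x) k.
Proof.
  intro Hb. apply cell_spec. unfold successor.
  destruct (proj1 (cell_spec grid x _) eq_refl) as [H1 H2].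
  set (j := cell grid x) in *. set (z := (j + Z.of_nat k * grid)%Z).
  assert (Hbz : (0 < Z.of_nat b)%Z) by lia.
  pose proof (Z.div_mod z (Z.of_nat b) ltac:(lia)) as E.
  pose proof (Z.mod_pos_bound z (Z.of_nat b) Hbz) as [M1 M2].
  set (s := (z / Z.of_nat b)%Z) in *. set (m := (z mod Z.of_nat b)%Z) in *.
  assert (M3 : IZR m + 1 <= IZR (Z.of_nat b)) by (rewrite <- plus_IZR; apply IZR_le; lia).
  apply IZR_le in M1. apply (f_equal IZR) in E. unfold z in E.
  rewrite !plus_IZR, !mult_IZR, <- !INR_IZR_INZ in E. rewrite <- INR_IZR_INZ in M3.
  apply (lt_INR 0) in Hb. simpl in Hb.
  assert (Ey : IZR grid * ((x + INR k) / INR b) = (IZR grid * x + INR k * IZR grid) / INR b)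
    by (field; lra).
  rewrite Ey. split.
  - apply Rmult_le_reg_r with (INR b); [exact Hb |]. unfold Rdiv. rewrite (Rmult_assoc _ (/ INR b)), Rinv_l by lra. lra.
  - apply Rmult_lt_reg_r with (INR b); [exact Hb |]. unfold Rdiv. rewrite (Rmult_assoc _ (/ INR b)), Rinv_l by lra. lra.
Qed.

Lemma sumR_IZR (f : nat -> Z) (d : R) (l : list nat) :
  sumR l (fun m => IZR (f m) / d) = IZR (fold_right Z.add 0%Z (map f l)) / d.
Proof.
  unfold sumR. induction l as [| m l IH]; cbn [map fold_right]; [unfold Rdiv; ring |].
  rewrite plus_IZR, IH. unfold Rdiv. ring.
Qed.

(** A cell outside the window lies in a stretch where the search has refuted tangency for the whole
    range of gamma. *)
Lemma may_touch_sound (c : certificate) (b : nat) (gamma x : R) (k l : nat) :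
  (2 <= b)%nat -> 0 < gamma < 1 -> (0 < gd c)%Z -> IZR (g0 c) / IZR (gd c) <= gamma <= IZR (g1 c) / IZR (gd c) ->
  check_windows c b = true -> 0 <= x < 1 -> k <> l ->
  E_set b gamma 1 x tol (tol / INR b) [k] [l] -> may_touch c (cell grid x) k l = true.
Proof.
  intros Hb Hg Hgd Hgr Hc Hx Hkl HE.
  assert (Hlt : forall k l, (k < l)%nat -> E_set b gamma 1 x tol (tol / INR b) [k] [l] ->
                may_touch c (cell grid x) k l = true).
  { clear k l Hkl HE. intros k l Hkl HE. pose proof HE as (Hk & Hl & _).
    apply word_1 in Hk as (k' & Hk & E). injection E as <-.
    apply word_1 in Hl as (l' & Hl & E). injection E as <-.
    pose proof (all_true_In _ _ k Hc ltac:(apply in_seq; lia)) as Hc1. cbv beta in Hc1.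
    pose proof (all_true_In _ _ l Hc1 ltac:(apply in_seq; lia)) as Hc2. cbv beta zeta in Hc2.
    apply Nat.ltb_lt in Hkl as Hkl'. rewrite Hkl' in Hc2.
    unfold may_touch. cbv zeta. rewrite Nat.min_l, Nat.max_r by lia.
    set (w := window c k l) in *.
    destruct (refute_cells c b 0 (fst w) k l) eqn:R1; [| discriminate]. rename Hc2 into R2.
    assert (Hcell : forall lo hi, (lo <= cell grid x < hi)%Z -> refute_cells c b lo hi k l = true -> False).
    { intros lo hi Hj HR. unfold refute_cells in HR.
      destruct (Z.ltb_spec lo hi); [| lia].
      erewrite refute_box_sound in HR; [discriminate | exact Hb | exact Hg | | | | exact HE].
      - split; [lra |]. apply Rlt_le, Hx.
      - apply in_enc_interval; assumption.
      - apply in_enc_interval; [reflexivity |].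
        destruct (proj1 (cell_spec grid x _) eq_refl) as [J1 J2].
        assert (L1 : IZR lo <= IZR (cell grid x)) by (apply IZR_le; lia).
        assert (L2 : IZR (cell grid x) + 1 <= IZR hi) by (rewrite <- plus_IZR; apply IZR_le; lia).
        change (IZR grid) with 64 in *. lra. }
    pose proof (cell_range grid x ltac:(reflexivity) Hx) as Hr.
    apply andb_true_intro. split.
    - apply Z.leb_le. destruct (Z_lt_le_dec (cell grid x) (fst w)); [| assumption].
      exfalso. apply (Hcell 0%Z (fst w)); [lia | exact R1].
    - apply Z.ltb_lt. destruct (Z_lt_le_dec (cell grid x) (snd w)); [assumption |].
      exfalso. apply (Hcell (snd w) grid); [lia | exact R2]. }
  destruct (Nat.lt_total k l) as [H | [H | H]]; [apply Hlt; assumption | contradiction |].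
  unfold may_touch. rewrite Nat.min_comm, Nat.max_comm. apply (Hlt l k H), E_set_sym, HE.
Qed.

(** Both omega and V are constant on cells, so the checked integer inequalities are the bounds on
    Sigma with denominators cleared. *)
Lemma certificate_sound (b : nat) (gamma : R) (c : certificate) :
  (2 <= b)%nat -> check b c = true -> 0 < gamma < 1 ->
  IZR (g0 c) / IZR (gd c) < gamma <= IZR (g1 c) / IZR (gd c) -> sigma_below b gamma.
Proof.
  intros Hb Hc Hg Hgr. unfold check in Hc.
  destruct (check_signs c b) eqn:Hs; [| discriminate].
  (* The table becomes a variable: only the facts verified by [check_omega] are kept, and no tactic
     can start computing it. *)
  revert Hc. generalize (omega_table c b). intros om Hc.
  destruct (check_omega c b om) eqn:Ho; [| discriminate]. rename Hc into Hw.
  unfold check_signs in Hs. rewrite !Bool.andb_true_iff, !Z.ltb_lt, Z.leb_le in Hs.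
  destruct Hs as [[[[[S1 S2] S3] S4] S5] S6].
  assert (Hom : forall j, (0 <= j < grid)%Z -> (1 <= lookup om j <= 1000000)%Z /\
     forall k, (k < b)%nat -> (lookup om j * row c b j k * rd c <=
                        rn c * lookup om (successor b j k) * (tn c * td c))%Z).
  { intros j Hj. pose proof (all_true_In _ _ j Ho (In_cells j Hj)) as H1. cbv beta in H1.
    destruct ((1 <=? lookup om j) && (lookup om j <=? 1000000))%Z%bool eqn:E; [| discriminate].
    rewrite Bool.andb_true_iff, !Z.leb_le in E. split; [exact E |].
    intros k Hk. pose proof (all_true_In _ _ k H1 ltac:(apply in_seq; lia)) as H2. cbv beta in H2.
    apply Z.leb_le, H2. }
  pose proof (IZR_lt _ _ S1) as Q1. pose proof (IZR_lt _ _ S2) as Q2.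
  pose proof (IZR_lt _ _ S3) as Q3. pose proof (IZR_lt _ _ S4) as Q4. pose proof (IZR_lt _ _ S5) as Q5.
  assert (HB : 2 <= INR b) by (apply INR_base_ge, Hb).
  set (T := IZR (tn c) * IZR (td c)). assert (HT : 0 < T) by (apply Rmult_lt_0_compat; assumption).
  apply (sigma_1_lt b gamma (IZR (rn c) / IZR (rd c)) (fun x => IZR (lookup om (cell grid x)))
    (fun x u v => IZR (weight c (cell grid x) (letter u) (letter v)) / T)).
  - split; [| split].
    + apply (meas_fun01_cell grid (fun j => IZR (lookup om j))). reflexivity.
    + intros x Hx. apply (IZR_lt 0). destruct (Hom _ (cell_range grid x ltac:(reflexivity) Hx)). lia.
    + exists 1000000. intros x Hx. destruct (Hom _ (cell_range grid x ltac:(reflexivity) Hx)) as [[H1 H2] _].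
      apply IZR_le in H1, H2. split; [exact H2 |].
      apply Rle_trans with 1; [| lra]. rewrite <- Rinv_1. apply Rinv_le_contravar; lra.
  - split; [| split].
    + intros u v _ _. apply (meas_fun01_cell grid (fun j => IZR (weight c j (letter u) (letter v)) / T)). reflexivity.
    + intros x u v _ _ _. apply Rdiv_le_0_compat; [| exact HT]. apply IZR_le.
      unfold weight. destruct Nat.eqb; [nia |]. destruct may_touch; [| lia]. destruct Bool.eqb; nia.
    + exists tol, (tol / INR b). assert (0 < tol) by (unfold tol; lra).
      split; [lra | split; [apply Rdiv_lt_0_compat; lra |]].
      intros x u v Hx HE. pose proof HE as (Hu & Hv & _).
      apply word_1 in Hu as (k & Hk & ->). apply word_1 in Hv as (l & Hl & ->).
      cbn [letter nth]. unfold weight. rewrite (Nat.eqb_sym l k).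
      destruct (Nat.eqb_spec k l) as [E | Hne].
      * rewrite mult_IZR. fold T. right. field. lra.
      * rewrite (may_touch_sound c b gamma x k l) by (assumption || lra).
        rewrite (may_touch_sound c b gamma x l k)
          by (assumption || lra || (apply not_eq_sym; assumption) || (apply E_set_sym; assumption)).
        (* Exchanging k and l flips the comparison, so the two entries are tn/td and td/tn in some
           order, with product 1. *)
        set (s := (2 * cell grid x <? grid)%Z).
        destruct (Nat.ltb_spec k l), (Nat.ltb_spec l k); try lia; destruct s; cbn [Bool.eqb];
          rewrite !mult_IZR; unfold T; right; field; lra.
  - split; [apply Rlt_le, Rdiv_lt_0_compat; assumption |].
    apply IZR_le in S6. rewrite !mult_IZR, <- INR_IZR_INZ in S6.
    apply Rle_lt_trans with (INR b * (IZR (g0 c) / IZR (gd c))); [| apply Rmult_lt_compat_l; lra].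
    apply Rmult_le_reg_r with (IZR (rd c) * IZR (gd c)); [apply Rmult_lt_0_compat; assumption |].
    replace (IZR (rn c) / IZR (rd c) * (IZR (rd c) * IZR (gd c))) with (IZR (rn c) * IZR (gd c)) by (field; lra).
    replace (INR b * (IZR (g0 c) / IZR (gd c)) * (IZR (rd c) * IZR (gd c)))
      with (IZR (rd c) * INR b * IZR (g0 c)) by (field; lra). exact S6.
  - intros x k Hx Hk. cbn [letter nth].
    rewrite (sumR_IZR (weight c (cell grid x) k)).
    rewrite xu_1, cell_successor by lia.
    pose proof (cell_range grid x ltac:(reflexivity) Hx) as Hj.
    assert (Hj' : (0 <= successor b (cell grid x) k < grid)%Z).
    { rewrite <- cell_successor, <- xu_1 by lia. apply cell_range; [reflexivity |].
      apply xu_1_range; assumption. }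
    destruct (Hom _ Hj) as [_ H2]. specialize (H2 k Hk).
    destruct (Hom _ Hj') as [[H3 _] _].
    fold (row c b (cell grid x) k).
    apply IZR_le in H2, H3. rewrite !mult_IZR in H2. fold T in H2.
    set (o := IZR (lookup om (cell grid x))) in *.
    set (o' := IZR (lookup om (successor b (cell grid x) k))) in *.
    set (w := IZR (row c b (cell grid x) k)) in *.
    apply Rmult_le_reg_r with (o' * T * IZR (rd c)); [repeat apply Rmult_lt_0_compat; lra |].
    replace (o / o' * (w / T) * (o' * T * IZR (rd c))) with (o * w * IZR (rd c)) by (field; lra).
    replace (IZR (rn c) / IZR (rd c) * (o' * T * IZR (rd c))) with (IZR (rn c) * o' * T) by (field; lra).
    exact H2.
Qed.

Lemma certified_range (b : nat) (gamma : R) (cs : list certificate) :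
  (2 <= b)%nat -> all_true (check b) cs = true -> 0 < gamma < 1 ->
  Exists (fun c => IZR (g0 c) / IZR (gd c) < gamma <= IZR (g1 c) / IZR (gd c)) cs ->
  sigma_below b gamma.
Proof.
  intros Hb Hcs Hg Hex. apply Exists_exists in Hex as (c & Hin & Hc).
  apply (certificate_sound b gamma c); [exact Hb | | exact Hg | exact Hc].
  exact (all_true_In _ _ c Hcs Hin).
Qed.

(** * Certificates for the bases 2 to 6 and the final case distinction *)

Definition touching (k l : nat) (lo hi : Z) : nat * nat * (Z * Z) := (k, l, (lo, hi)).

(** The bounds 1.1487, 1.1893, 1.26 and 1.4143 are 2^(1/5), 2^(1/4), 2^(1/3) and 2^(1/2) rounded up.
    In the last entry the window is [1/4, 3/4): one branch stays in it and has row sum 1.618, the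
    other leaves and has row sum about 1.618^2, which a larger omega outside compensates. *)
Definition certificates_2 : list certificate := [
  Certificate 5000 5760 10000 1 1 1 1 [];
  Certificate 5750 6000 10000 11487 10000 1 1 [touching 0 1 31 33];
  Certificate 5950 6500 10000 11893 10000 1 1 [touching 0 1 29 35];
  Certificate 6310 7085 10000 12600 10000 1 1 [touching 0 1 26 38];
  Certificate 7075 8095 10000 14143 10000 1 1 [touching 0 1 22 42];
  Certificate 8093 10000 10000 16185 10000 618 1000 [touching 0 1 16 48]].

(** The denominator 3000 makes the lower end exactly 1/3. Windows come in mirror pairs, since
    replacing x by 1 - x and each digit d by b - 1 - d changes the sign of S. Here and for bases 4
    and 5, the bounds 2 and 3 count the entries of a row, while 1.4143, just above the square root
    of 2, works because every branch with two entries leads outside all windows. *)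
Definition certificates_3 : list certificate := [
  Certificate 1000 1425 3000 1 1 1 1 [];
  Certificate 4720 6700 10000 14143 10000 1 1
    [touching 0 1 57 64; touching 0 2 25 39; touching 1 2 0 7];
  Certificate 6670 10000 10000 2 1 1 1
    [touching 0 1 48 64; touching 0 2 16 48; touching 1 2 0 16]].

Definition certificates_4 : list certificate := [
  Certificate 2500 4110 10000 1 1 1 1 [];
  Certificate 4100 5000 10000 14143 10000 1 1 [touching 0 3 26 38; touching 1 2 26 38];
  Certificate 5000 7600 10000 2 1 1 1
    [touching 0 3 18 46; touching 1 2 18 46; touching 0 2 50 64; touching 1 3 0 14];
  Certificate 7510 10000 10000 3 1 1 1
    [touching 0 3 11 53; touching 1 2 11 53; touching 0 2 43 64; touching 1 3 0 21]].

Definition certificates_5 : list certificate := [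
  Certificate 2000 3700 10000 1 1 1 1 [];
  Certificate 3650 4100 10000 14143 10000 1 1
    [touching 0 4 27 37; touching 1 2 59 64; touching 2 3 0 5];
  Certificate 4010 6100 10000 2 1 1 1
    [touching 0 4 17 47; touching 1 2 49 64; touching 2 3 0 15;
     touching 1 3 18 46; touching 0 3 50 64; touching 1 4 0 14];
  Certificate 6010 10000 10000 3 1 1 1
    [touching 0 4 7 57; touching 1 2 39 64; touching 2 3 0 25;
     touching 1 3 15 49; touching 0 3 47 64; touching 1 4 0 17]].

Definition certificates_6 : list certificate := [Certificate 1000 2004 6000 1 1 1 1 []].

Lemma certificates_2_checked : all_true (check 2) certificates_2 = true.
Proof. vm_compute. reflexivity. Qed.

Lemma certificates_3_checked : all_true (check 3) certificates_3 = true.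
Proof. vm_compute. reflexivity. Qed.

Lemma certificates_4_checked : all_true (check 4) certificates_4 = true.
Proof. vm_compute. reflexivity. Qed.

Lemma certificates_5_checked : all_true (check 5) certificates_5 = true.
Proof. vm_compute. reflexivity. Qed.

Lemma certificates_6_checked : all_true (check 6) certificates_6 = true.
Proof. vm_compute. reflexivity. Qed.

(** The ranges overlap and the first one starts at 1/b, so the first range whose upper end is not
    below [gamma] contains it. *)
Ltac find_range gamma :=
  lazymatch goal with
  | |- Exists _ (Certificate _ ?hi ?den _ _ _ _ _ :: _) =>
      destruct (Rle_dec gamma (IZR hi / IZR den));
      [apply Exists_cons_hd; cbn [g0 g1 gd]; lra | apply Exists_cons_tl; find_range gamma]
  | |- _ => exfalso; lra
  end.

(* sigma(q) < (b gamma)^q, with sigma(q) = inf_{omega,V} ||Sigma_{V,omega}||_oo *)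
Theorem theorem2p8 (b : nat) (gamma : R) :
  (2 <= b)%nat -> / INR b < gamma -> gamma < 1 ->
  exists q : nat, (1 <= q)%nat /\
    exists (omega : R -> R) (V : R -> list nat -> list nat -> R),
      weight_fun omega /\ admissible b gamma q V /\
      esssup_lt (Sigma b q V omega) ((INR b * gamma) ^ q).
Proof.
  intros Hb Hlow Hg1. change (sigma_below b gamma).
  pose proof (INR_base_ge b Hb) as HB.
  assert (Hg : 0 < gamma < 1) by (pose proof (Rinv_0_lt_compat (INR b)); lra).
  destruct (Nat.le_gt_cases 7 b) as [H7 | H7].
  - destruct (Rle_dec (INR b * gamma) 2) as [H | H].
    + apply sigma_below_large_base_small_gamma; [exact H7 | split; assumption | exact H].
    + apply sigma_below_large_base_large_gamma; [lia | exact Hg1 | lra].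
  - assert (Hcase : (b = 2 \/ b = 3 \/ b = 4 \/ b = 5 \/ b = 6)%nat) by lia.
    destruct Hcase as [-> | [-> | [-> | [-> | ->]]]]; cbn [INR] in Hlow;
      match type of Hlow with / ?d < _ => field_simplify d in Hlow end.
    + apply (certified_range 2 gamma certificates_2 Hb certificates_2_checked Hg).
      unfold certificates_2. find_range gamma.
    + apply (certified_range 3 gamma certificates_3 Hb certificates_3_checked Hg).
      unfold certificates_3. find_range gamma.
    + apply (certified_range 4 gamma certificates_4 Hb certificates_4_checked Hg).
      unfold certificates_4. find_range gamma.
    + apply (certified_range 5 gamma certificates_5 Hb certificates_5_checked Hg).
      unfold certificates_5. find_range gamma.
    (* Base 6 needs both methods: beyond 0.334 the product 6 gamma exceeds 2 and the counting
       argument applies. *)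
    + destruct (Rle_dec gamma (2004 / 6000)) as [H | H].
      * apply (certified_range 6 gamma certificates_6 Hb certificates_6_checked Hg).
        unfold certificates_6. find_range gamma.
      * apply sigma_below_large_base_large_gamma; [lia | exact Hg1 | simpl; lra].
Qed.
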